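(* Let $K$ be a commutative ring, $A$ a unital $K$-algebra and $\mathfrak{C}$ an $A$-coring. Assume that the category $\mathcal{M}^{\mathfrak{C}}$ of right $\mathfrak{C}$-comodules is abelian, and that there is a generating set $\mathcal{A}$ of right $\mathfrak{C}$-comodules such that $P_A$ is finitely generated and projective for every $P\in\mathcal{A}$. If $\Sigma=\bigoplus_{P\in\mathcal{A}}P$ and $T=\mathrm{End}_{\mathfrak{C}}(\Sigma)$, then $\mathsf{can}:\Sigma^*\otimes_T\Sigma\rightarrow\mathfrak{C}$ is an isomorphism of $A$-corings.
   Context: An $A$-coring is an $A$-bimodule $\mathfrak{C}$ (with $K$ acting centrally) with $A$-bimodule maps $\Delta:\mathfrak{C}\to\mathfrak{C}\otimes_A\mathfrak{C}$ (coassociative) and $\epsilon:\mathfrak{C}\to A$ (counit for $\Delta$). A right $\mathfrak{C}$-comodule is a right $A$-module $M$ with a right $A$-linear map $\rho_M:M\to M\otimes_A\mathfrak{C}$ that is coassociative and counital; morphisms are the right $A$-linear colinear maps; $\mathcal{M}^{\mathfrak{C}}$ is the resulting category (coproducts and cokernels are computed in right $A$-modules). $\mathrm{End}_{\mathfrak{C}}(\Sigma)$ is the endomorphism ring of $\Sigma$ in $\mathcal{M}^{\mathfrak{C}}$. $\Sigma$ is a $T$-$A$-bimodule and $\Sigma^*=\mathrm{Hom}_A(\Sigma,A)$ is an $A$-$T$-bimodule. For $P\in\mathcal{A}$ let $\pi_P:\Sigma\to P$ and $\iota_P:P\to\Sigma$ be the canonical projection and injection, and $\{e_{\alpha_P}^*,e_{\alpha_P}\}$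 a finite dual basis of $P_A$. The $A$-bimodule $\Sigma^*\otimes_T\Sigma$ is an $A$-coring (the infinite comatrix coring) with counit $\varphi\otimes_Tu\mapsto\varphi(u)$ and comultiplication $$\Delta(\varphi\otimes_Tu)=\sum_{P\in\mathcal{F}}\sum_{\alpha_P}\varphi\iota_P\pi_P\otimes_T\iota_P(e_{\alpha_P})\otimes_Ae_{\alpha_P}^*\pi_P\otimes_T\iota_P\pi_P(u),$$ where $\mathcal{F}\subseteq\mathcal{A}$ is any finite set with $u=\sum_{P\in\mathcal{F}}\iota_P\pi_P(u)$. The homomorphism of $A$-corings $\mathsf{can}:\Sigma^*\otimes_T\Sigma\to\mathfrak{C}$ is given by $\mathsf{can}(\varphi\otimes_Tu)=(\varphi\otimes_A\mathfrak{C})\rho_\Sigma(u)$. *)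

(* Defs.v *)
From HB Require Import structures.
From mathcomp Require Import all_boot all_algebra.
From mathcomp Require Import boolp.

Set Implicit Arguments.
Unset Strict Implicit.
Unset Printing Implicit Defensive.

Import GRing.Theory.
Local Open Scope ring_scope.
Local Open Scope quotient_scope.

(* ssralg's algType excludes the zero ring, which is an admissible K-algebra
   here; hence this record. *)
Record kalgebra (K : comPzRingType) := KAlgebra {
  kalg_ring :> pzRingType;
  kalg_in : {rmorphism K -> kalg_ring};
  kalg_inC : forall k a, kalg_in k * a = a * kalg_in k }.

HB.mixin Record Zmodule_isRmodule (R : pzRingType) V of GRing.Zmodule V := {
  ract : V -> R -> V;
  ractA : forall v a b, ract (ract v a) b = ract v (a * b);
  ract1 : forall v, ract v 1 = v;
  ractDl : forall a, {morph ract^~ a : u v / u + v};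
  ractDr : forall v, {morph ract v : a b / a + b} }.

#[short(type="rmodType")]
HB.structure Definition Rmodule (R : pzRingType) :=
  {V of GRing.Zmodule V & Zmodule_isRmodule R V}.

Notation "v *< a" := (ract v a) (at level 40, left associativity) : ring_scope.

HB.mixin Record isBimodule (L R : pzRingType) V
    of GRing.Lmodule L V & Rmodule R V := {
  ractZ : forall (a : L) (v : V) (b : R), (a *: v) *< b = a *: (v *< b) }.

#[short(type="bimodType")]
HB.structure Definition Bimodule (L R : pzRingType) :=
  {V of GRing.Lmodule L V & Rmodule R V & isBimodule L R V}.

HB.instance Definition _ (R : pzRingType) :=
  Zmodule_isRmodule.Build R R^o (fun v a b => esym (mulrA v a b)) (@mulr1 R)
    (fun a u v => mulrDl u v a) (@mulrDr R).
HB.instance Definition _ (R : pzRingType) :=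
  isBimodule.Build R R R^o (fun a v b => esym (mulrA a v b)).

Section MapPredicates.

Definition additive_map (U V : zmodType) (f : U -> V) :=
  {morph f : x y / x + y}.

Definition rmod_map (R : pzRingType) (U V : rmodType R) (f : U -> V) :=
  additive_map f /\ forall u a, f (u *< a) = f u *< a.

Definition lmod_map (L : pzRingType) (U V : lmodType L) (f : U -> V) :=
  additive_map f /\ forall a u, f (a *: u) = a *: f u.

Definition bimod_map (L R : pzRingType) (U V : bimodType L R) (f : U -> V) :=
  rmod_map f /\ forall a u, f (a *: u) = a *: f u.

Definition balanced (S : pzRingType) (M : rmodType S) (N : lmodType S)
    (V : zmodType) (f : M -> N -> V) :=
  [/\ forall n, additive_map (f^~ n),
      forall m, additive_map (f m) &
      forall m s n, f (m *< s) n = f m (s *: n)].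

End MapPredicates.

Section Tensor.
Variables (S : pzRingType) (M : rmodType S) (N : lmodType S).

(* M (x)_S N by generators and relations: a list of pairs stands for the sum of
   the corresponding pure tensors, and [teq] is the congruence generated by the
   relations of the tensor product.  No formal negatives are needed, since
   - (m (x) n) = (- m) (x) n. *)
Inductive teq : seq (M * N) -> seq (M * N) -> Prop :=
| teq_refl s : teq s s
| teq_sym s t : teq s t -> teq t s
| teq_trans s t u : teq s t -> teq t u -> teq s u
| teq_cat s s' t t' : teq s s' -> teq t t' -> teq (s ++ t) (s' ++ t')
| teq_catC s t : teq (s ++ t) (t ++ s)
| teq_0 n : teq [:: (0, n)] [::]
| teq_Dl m m' n : teq [:: (m + m', n)] [:: (m, n); (m', n)]
| teq_Dr m n n' : teq [:: (m, n + n')] [:: (m, n); (m, n')]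
| teq_bal m s n : teq [:: (m *< s, n)] [:: (m, s *: n)].

Definition teqb : rel (seq (M * N)) := fun s t => `[< teq s t >].

Lemma teqb_refl : reflexive teqb.
Proof. by move=> s; apply/asboolP; apply: teq_refl. Qed.

Lemma teqb_sym : symmetric teqb.
Proof. by move=> s t; apply/asboolP/asboolP; apply: teq_sym. Qed.

Lemma teqb_trans : transitive teqb.
Proof.
by move=> t s u /asboolP st /asboolP tu; apply/asboolP; apply: teq_trans tu.
Qed.

Canonical teq_equiv := EquivRel teqb teqb_refl teqb_sym teqb_trans.

Definition tensor : Type := {eq_quot teq_equiv}.
HB.instance Definition _ := Choice.on tensor.
HB.instance Definition _ := Quotient.on tensor.

Definition tensor_of (s : seq (M * N)) : tensor := \pi_tensor s.

Lemma tensor_ofP s t : teq s t -> tensor_of s = tensor_of t.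
Proof. by move=> st; apply/eqmodP/asboolP. Qed.

Lemma tensor_ofK (x : tensor) : tensor_of (repr x) = x.
Proof. exact: reprK. Qed.

Lemma teq_repr s : teq (repr (tensor_of s)) s.
Proof.
by have /eqmodP/asboolP := tensor_ofK (tensor_of s).
Qed.

Definition tadd (x y : tensor) : tensor := tensor_of (repr x ++ repr y).
Definition topp (x : tensor) : tensor :=
  tensor_of [seq (- p.1, p.2) | p <- repr x].

Lemma tadd_of s t : tadd (tensor_of s) (tensor_of t) = tensor_of (s ++ t).
Proof. by apply: tensor_ofP; apply: teq_cat; apply: teq_repr. Qed.

Lemma taddA : associative tadd.
Proof.
move=> x y z; rewrite -(tensor_ofK x) -(tensor_ofK y) -(tensor_ofK z).
by rewrite !tadd_of catA.
Qed.

Lemma taddC : commutative tadd.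
Proof.
move=> x y; rewrite -(tensor_ofK x) -(tensor_ofK y) !tadd_of.
exact/tensor_ofP/teq_catC.
Qed.

Lemma tadd0 : left_id (tensor_of [::]) tadd.
Proof. by move=> x; rewrite -(tensor_ofK x) tadd_of. Qed.

Lemma taddN : left_inverse (tensor_of [::]) topp tadd.
Proof.
move=> x; rewrite -{2}(tensor_ofK x) /topp tadd_of; apply: tensor_ofP.
elim: (repr x) => [|[m n] s IHs] /=; first exact: teq_refl.
set u := map _ s in IHs *.
have perm : teq ((- m, n) :: u ++ (m, n) :: s)
                ([:: (- m, n); (m, n)] ++ (u ++ s)).
  apply: (@teq_cat [:: (- m, n)] [:: (- m, n)] (u ++ (m, n) :: s)
                   ((m, n) :: u ++ s)); first exact: teq_refl.
  rewrite -cat1s -[(m, n) :: u ++ s]cat1s !catA.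
  by apply: teq_cat; [apply: teq_catC | apply: teq_refl].
apply: teq_trans perm _; rewrite -[[::]]/([::] ++ [::]).
apply: teq_cat => //; apply: (teq_trans (teq_sym (teq_Dl _ _ _))).
by rewrite addNr; apply: teq_0.
Qed.

HB.instance Definition _ := GRing.isZmodule.Build tensor taddA taddC tadd0 taddN.

Definition tpure (m : M) (n : N) : tensor := tensor_of [:: (m, n)].
Local Notation "m \ox n" := (tpure m n) (at level 40, left associativity).

Lemma tensor_of_cons m n s : tensor_of ((m, n) :: s) = m \ox n + tensor_of s.
Proof. by rewrite -cat1s -tadd_of. Qed.

Lemma tpure_balanced : balanced tpure.
Proof.
split=> [n m m'|m n n'|m s n].
- by rewrite [RHS]tadd_of; apply/tensor_ofP/teq_Dl.
- by rewrite [RHS]tadd_of; apply/tensor_ofP/teq_Dr.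
- exact/tensor_ofP/teq_bal.
Qed.

Lemma tensor_ind (P : tensor -> Prop) :
  (forall m n, P (m \ox n)) -> (forall x y, P x -> P y -> P (x + y)) ->
  forall x, P x.
Proof.
move=> Pp PD x; rewrite -(tensor_ofK x); elim: (repr x) => [|[m n] s IHs].
  by have := Pp 0 0; rewrite /tpure (tensor_ofP (teq_0 _)).
by rewrite tensor_of_cons; apply: PD.
Qed.

(* The additive map M (x)_S N -> V with m (x) n |-> f m n.  It is given by a total
   formula so that no proof has to be carried around, but it is meaningful
   (independent of the representative) only for balanced f, see [tlift_pure]. *)
Definition tlift (V : zmodType) (f : M -> N -> V) (x : tensor) : V :=
  \sum_(p <- repr x) f p.1 p.2.

Section Lift.
Variables (V : zmodType) (f : M -> N -> V).
Hypothesis fB : balanced f.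

Lemma bal0l n : f 0 n = 0.
Proof. by case: fB => fl _ _; apply: (addIr (f 0 n)); rewrite -fl !add0r. Qed.

Lemma tlift_of s : tlift f (tensor_of s) = \sum_(p <- s) f p.1 p.2.
Proof.
case: fB => fl fr fs.
suff teq_sum u v : teq u v ->
    \sum_(p <- u) f p.1 p.2 = \sum_(p <- v) f p.1 p.2.
  exact: teq_sum (teq_repr s).
elim=> {s u v} //=.
- by move=> s t u _ -> _ ->.
- by move=> s s' t t' _ IH1 _ IH2; rewrite !big_cat IH1 IH2.
- by move=> s t; rewrite !big_cat /= addrC.
- by move=> n; rewrite big_seq1 big_nil bal0l.
- by move=> m m' n; rewrite !big_cons !big_nil /= !addr0; apply: fl.
- by move=> m n n'; rewrite !big_cons !big_nil /= !addr0; apply: fr.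
- by move=> m s n; rewrite !big_seq1 /=.
Qed.

Lemma tlift_pure m n : tlift f (m \ox n) = f m n.
Proof. by rewrite tlift_of big_seq1. Qed.

Lemma tliftD : additive_map (tlift f).
Proof.
move=> x y; rewrite -(tensor_ofK x) -(tensor_ofK y) -[_ + _]/(tadd _ _).
by rewrite tadd_of !tlift_of big_cat.
Qed.

End Lift.

Lemma tensor_eq (V : zmodType) (f g : tensor -> V) :
  additive_map f -> additive_map g -> (forall m n, f (m \ox n) = g (m \ox n)) ->
  f =1 g.
Proof. by move=> fD gD fg; elim/tensor_ind=> // x y fx fy; rewrite fD gD fx fy. Qed.

End Tensor.

Notation "m \ox n" := (tpure m n) (at level 40, left associativity) : ring_scope.

Section TensorMaps.

Lemma additive_map0 (U V : zmodType) (f : U -> V) : additive_map f -> f 0 = 0.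
Proof. by move=> fD; apply: (addIr (f 0)); rewrite -fD !add0r. Qed.

Lemma additive_mapN (U V : zmodType) (f : U -> V) x :
  additive_map f -> f (- x) = - f x.
Proof.
by move=> fD; apply: (addIr (f x)); rewrite -fD !addNr additive_map0.
Qed.

Lemma additive_map_sum (U V : zmodType) (f : U -> V) (I : Type) (r : seq I)
    (F : I -> U) : additive_map f -> f (\sum_(i <- r) F i) = \sum_(i <- r) f (F i).
Proof. by move=> fD; rewrite (big_morph f fD (additive_map0 fD)). Qed.

Lemma additive_map_id (U : zmodType) : additive_map (@id U).
Proof. by []. Qed.

Lemma additive_map_comp (U V W : zmodType) (g : V -> W) (f : U -> V) :
  additive_map g -> additive_map f -> additive_map (fun x => g (f x)).
Proof. by move=> gD fD x y; rewrite fD gD. Qed.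

Lemma ract0 (R : pzRingType) (V : rmodType R) (v : V) : v *< 0 = 0.
Proof. exact: (additive_map0 (ractDr v)). Qed.

Lemma rmod_map_id (R : pzRingType) (U : rmodType R) : rmod_map (@id U).
Proof. by []. Qed.

Lemma lmod_map_id (L : pzRingType) (U : lmodType L) : lmod_map (@id U).
Proof. by []. Qed.

Lemma rmod_map_comp (R : pzRingType) (U V W : rmodType R)
    (g : V -> W) (f : U -> V) :
  rmod_map g -> rmod_map f -> rmod_map (fun x => g (f x)).
Proof.
move=> [gD gR] [fD fR]; split=> [|u a]; first exact: additive_map_comp.
by rewrite fR gR.
Qed.

Lemma rmod_map_scale (L R : pzRingType) (U : bimodType L R) (a : L) :
  rmod_map (fun u : U => a *: u).
Proof. by split=> [u v|u b]; rewrite ?scalerDr ?ractZ. Qed.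

Lemma lmod_map_ract (L R : pzRingType) (U : bimodType L R) (b : R) :
  lmod_map (fun u : U => u *< b).
Proof. by split=> [u v|a u]; rewrite ?ractDl ?ractZ. Qed.

Variables (S : pzRingType).
Implicit Types (M : rmodType S) (N : lmodType S).

Lemma tpureDl M N (m m' : M) (n : N) : (m + m') \ox n = m \ox n + m' \ox n.
Proof. by case: (tpure_balanced M N) => + _ _; apply. Qed.

Lemma tpureDr M N (m : M) (n n' : N) : m \ox (n + n') = m \ox n + m \ox n'.
Proof. by case: (tpure_balanced M N) => _ + _; apply. Qed.

Lemma tpureA M N (m : M) s (n : N) : (m *< s) \ox n = m \ox (s *: n).
Proof. by case: (tpure_balanced M N) => _ _; apply. Qed.

Lemma tpure0l M N (n : N) : (0 : M) \ox n = 0.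
Proof. by apply: (additive_map0 (f := fun m : M => m \ox n)) => ? ?; apply: tpureDl. Qed.

Lemma tpure0r M N (m : M) : m \ox (0 : N) = 0.
Proof. by apply: (additive_map0 (f := fun n : N => m \ox n)) => ? ?; apply: tpureDr. Qed.

Lemma tpure_suml M N (I : Type) (r : seq I) (F : I -> M) (n : N) :
  (\sum_(i <- r) F i) \ox n = \sum_(i <- r) F i \ox n.
Proof. by apply: (additive_map_sum (f := fun m : M => m \ox n)) => ? ?; apply: tpureDl. Qed.

Lemma tpure_sumr M N (I : Type) (r : seq I) (F : I -> N) (m : M) :
  m \ox (\sum_(i <- r) F i) = \sum_(i <- r) m \ox F i.
Proof. by apply: (additive_map_sum (f := fun n : N => m \ox n)) => ? ?; apply: tpureDr. Qed.

Lemma tlift_comp M N (V W : zmodType) (h : V -> W) (f : M -> N -> V) x :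
  additive_map h -> h (tlift f x) = tlift (fun m n => h (f m n)) x.
Proof. exact: additive_map_sum. Qed.

Lemma eq_tlift M N (V : zmodType) (f g : M -> N -> V) x :
  (forall m n, f m n = g m n) -> tlift f x = tlift g x.
Proof. by move=> fg; apply: eq_bigr => p _; apply: fg. Qed.

Lemma tlift_funD M N (V : zmodType) (f g h : M -> N -> V) x :
  (forall m n, f m n = g m n + h m n) -> tlift f x = tlift g x + tlift h x.
Proof. by move=> fg; rewrite -big_split; apply: eq_bigr => p _; apply: fg. Qed.

Definition tmap M M' N N' (f : M -> M') (g : N -> N') : tensor M N -> tensor M' N' :=
  tlift (fun m n => f m \ox g n).

Lemma tmap_balanced M M' N N' (f : M -> M') (g : N -> N') :
  rmod_map f -> lmod_map g -> balanced (fun m n => f m \ox g n).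
Proof.
move=> [fD fR] [gD gL]; split=> [n m m'|m n n'|m s n].
- by rewrite fD tpureDl.
- by rewrite gD tpureDr.
- by rewrite fR gL tpureA.
Qed.

Lemma tmap_pure M M' N N' (f : M -> M') (g : N -> N') :
  rmod_map f -> lmod_map g -> forall m n, tmap f g (m \ox n) = f m \ox g n.
Proof. by move=> fR gL m n; apply/tlift_pure/tmap_balanced. Qed.

Lemma tmapD M M' N N' (f : M -> M') (g : N -> N') :
  rmod_map f -> lmod_map g -> additive_map (tmap f g).
Proof. by move=> fR gL; apply/tliftD/tmap_balanced. Qed.

End TensorMaps.

Section TensorLeftModule.
Variables (L S : pzRingType) (M : bimodType L S) (N : lmodType S).

Definition tlact (a : L) : tensor M N -> tensor M N :=
  tmap (fun m : M => a *: m) id.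

Lemma tlact_pure a m n : tlact a (m \ox n) = (a *: m) \ox n.
Proof. by rewrite /tlact tmap_pure//; apply: rmod_map_scale. Qed.

Lemma tlactDr : right_distributive tlact +%R.
Proof. by move=> a; apply: tmapD; first apply: rmod_map_scale. Qed.

Lemma tlactA a b x : tlact a (tlact b x) = tlact (a * b) x.
Proof.
elim/tensor_ind: x => [m n|x y IHx IHy]; last by rewrite !tlactDr IHx IHy.
by rewrite !tlact_pure scalerA.
Qed.

Lemma tlact1 : left_id 1 tlact.
Proof.
by elim/tensor_ind=> [m n|x y IHx IHy]; rewrite (tlact_pure, tlactDr) ?IHx ?IHy ?scale1r.
Qed.

Lemma tlactDl x : {morph tlact^~ x : a b / a + b}.
Proof.
move=> a b /=; elim/tensor_ind: x => [m n|x y IHx IHy].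
  by rewrite !tlact_pure scalerDl tpureDl.
by rewrite !tlactDr IHx IHy addrACA.
Qed.

HB.instance Definition _ := GRing.Zmodule_isLmodule.Build L (tensor M N)
  tlactA tlact1 tlactDr tlactDl.

Lemma scale_pure a (m : M) (n : N) : a *: (m \ox n) = (a *: m) \ox n.
Proof. exact: tlact_pure. Qed.

End TensorLeftModule.

Section TensorRightModule.
Variables (S R : pzRingType) (M : rmodType S) (N : bimodType S R).

Definition tract (x : tensor M N) (b : R) : tensor M N :=
  tmap id (fun n : N => n *< b) x.

Lemma tract_pure m n b : tract (m \ox n) b = m \ox (n *< b).
Proof. by rewrite /tract tmap_pure//; apply: lmod_map_ract. Qed.

Lemma tractDl b : {morph tract^~ b : x y / x + y}.
Proof. by apply: tmapD => //; apply: lmod_map_ract. Qed.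

Lemma tractA x a b : tract (tract x a) b = tract x (a * b).
Proof.
elim/tensor_ind: x => [m n|x y IHx IHy]; last by rewrite !tractDl IHx IHy.
by rewrite !tract_pure ractA.
Qed.

Lemma tract1 x : tract x 1 = x.
Proof.
elim/tensor_ind: x => [m n|x y IHx IHy]; last by rewrite tractDl IHx IHy.
by rewrite tract_pure ract1.
Qed.

Lemma tractDr x : {morph tract x : a b / a + b}.
Proof.
move=> a b /=; elim/tensor_ind: x => [m n|x y IHx IHy].
  by rewrite !tract_pure ractDr tpureDr.
by rewrite !tractDl IHx IHy addrACA.
Qed.

HB.instance Definition _ := Zmodule_isRmodule.Build R (tensor M N)
  tractA tract1 tractDl tractDr.

Lemma ract_pure (m : M) (n : N) b : (m \ox n) *< b = m \ox (n *< b).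
Proof. exact: tract_pure. Qed.

End TensorRightModule.

Section TensorBimodule.
Variables (L S R : pzRingType) (M : bimodType L S) (N : bimodType S R).

Lemma tractZ (a : L) (x : tensor M N) (b : R) : (a *: x) *< b = a *: (x *< b).
Proof.
elim/tensor_ind: x => [m n|x y IHx IHy].
  by rewrite scale_pure !ract_pure scale_pure.
by rewrite scalerDr !ractDl scalerDr IHx IHy.
Qed.

HB.instance Definition _ := isBimodule.Build L R (tensor M N) tractZ.

End TensorBimodule.

Section TensorAssoc.
Variables (S R : pzRingType).

Definition tassoc (M : rmodType S) (N : bimodType S R) (P : lmodType R) :
    tensor (tensor M N) P -> tensor M (tensor N P) :=
  tlift (fun x p => tlift (fun m n => m \ox (n \ox p)) x).

Variables (M : rmodType S) (N : bimodType S R) (P : lmodType R).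

Lemma tassoc_balanced1 (p : P) :
  balanced (fun (m : M) (n : N) => m \ox (n \ox p)).
Proof.
split=> [n m m'|m n n'|m s n].
- by rewrite tpureDl.
- by rewrite tpureDl tpureDr.
- by rewrite tpureA scale_pure.
Qed.

Lemma tassoc_balanced : balanced (fun (x : tensor M N) (p : P) =>
  tlift (fun m n => m \ox (n \ox p)) x).
Proof.
split=> [p|x p p'|x s p]; first exact/tliftD/tassoc_balanced1.
  by apply: tlift_funD => m n; rewrite !tpureDr.
elim/tensor_ind: x => [m n|x y IHx IHy].
  by rewrite ract_pure !(tlift_pure (tassoc_balanced1 _)) tpureA.
by rewrite ractDl !(tliftD (tassoc_balanced1 _)) IHx IHy.
Qed.

Lemma tassoc_pure (m : M) (n : N) (p : P) :
  tassoc ((m \ox n) \ox p) = m \ox (n \ox p).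
Proof.
by rewrite /tassoc (tlift_pure tassoc_balanced) (tlift_pure (tassoc_balanced1 _)).
Qed.

Lemma tassocD : additive_map (@tassoc M N P).
Proof. exact/tliftD/tassoc_balanced. Qed.

End TensorAssoc.

Lemma tmap_rmod_map (S R : pzRingType) (M M' : rmodType S) (N N' : bimodType S R)
    (f : M -> M') (g : N -> N') :
  rmod_map f -> bimod_map g -> rmod_map (tmap f g).
Proof.
move=> fR [gR gL]; have gM : lmod_map g by split=> //; case: gR.
split=> [|x b]; first exact: tmapD.
elim/tensor_ind: x => [m n|x y IHx IHy].
  by rewrite ract_pure !tmap_pure// ract_pure; case: gR => _ ->.
by rewrite ractDl !(tmapD fR gM) ractDl IHx IHy.
Qed.

Lemma tmap_lmod_map (L S : pzRingType) (M M' : bimodType L S) (N N' : lmodType S)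
    (f : M -> M') (g : N -> N') :
  bimod_map f -> lmod_map g -> lmod_map (tmap f g).
Proof.
move=> [fR fL] gM; split=> [|b x]; first exact: tmapD.
elim/tensor_ind: x => [m n|x y IHx IHy].
  by rewrite scale_pure !tmap_pure// scale_pure fL.
by rewrite scalerDr !(tmapD fR gM) scalerDr IHx IHy.
Qed.

Section RHom.
Variable R : pzRingType.

Record rhom (M N : rmodType R) := RHom {
  rfun :> M -> N;
  rfun_map : rmod_map rfun }.

Variables (M N : rmodType R).

HB.instance Definition _ := gen_eqMixin (rhom M N).
HB.instance Definition _ := gen_choiceMixin (rhom M N).

Lemma rhom_ext (f g : rhom M N) : f =1 g -> f = g.
Proof.
case: f g => f fP [g gP] /= /funext fg; case: _ / fg in gP *.
by congr RHom; apply: Prop_irrelevance.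
Qed.

Implicit Types f g : rhom M N.

Lemma rhomD f : additive_map f. Proof. by case: (rfun_map f). Qed.
Lemma rhomR f u a : f (u *< a) = f u *< a. Proof. by case: (rfun_map f). Qed.

Fact rhom_zero_map : rmod_map (fun _ : M => 0 : N).
Proof.
split=> [x y|u a]; first by rewrite addr0.
by rewrite (additive_map0 (ractDl a)).
Qed.

Fact rhom_opp_map f : rmod_map (fun u => - f u).
Proof.
split=> [x y|u a]; first by rewrite rhomD opprD.
by rewrite rhomR (additive_mapN _ (ractDl a)).
Qed.

Fact rhom_add_map f g : rmod_map (fun u => f u + g u).
Proof.
split=> [x y|u a]; first by rewrite !rhomD addrACA.
by rewrite !rhomR ractDl.
Qed.

Definition rhom_zero := RHom rhom_zero_map.
Definition rhom_opp f := RHom (rhom_opp_map f).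
Definition rhom_add f g := RHom (rhom_add_map f g).

Fact rhom_addA : associative rhom_add.
Proof. by move=> f g h; apply: rhom_ext => u /=; rewrite addrA. Qed.
Fact rhom_addC : commutative rhom_add.
Proof. by move=> f g; apply: rhom_ext => u /=; rewrite addrC. Qed.
Fact rhom_add0 : left_id rhom_zero rhom_add.
Proof. by move=> f; apply: rhom_ext => u /=; rewrite add0r. Qed.
Fact rhom_addN : left_inverse rhom_zero rhom_opp rhom_add.
Proof. by move=> f; apply: rhom_ext => u /=; rewrite addNr. Qed.

HB.instance Definition _ := GRing.isZmodule.Build (rhom M N)
  rhom_addA rhom_addC rhom_add0 rhom_addN.

Lemma rhom0E u : (0 : rhom M N) u = 0. Proof. by []. Qed.
Lemma rhomDE f g u : (f + g) u = f u + g u. Proof. by []. Qed.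
Lemma rhomNE f u : (- f) u = - f u. Proof. by []. Qed.
Lemma rhom_sumE (I : Type) (r : seq I) (F : I -> rhom M N) u :
  (\sum_(i <- r) F i) u = \sum_(i <- r) F i u.
Proof. by elim: r => [|i r IH]; rewrite ?big_nil// !big_cons rhomDE IH. Qed.

End RHom.

Definition rhom_id (R : pzRingType) (M : rmodType R) : rhom M M :=
  RHom (rmod_map_id M).

Definition rhom_comp (R : pzRingType) (M N P : rmodType R)
    (g : rhom N P) (f : rhom M N) : rhom M P :=
  RHom (rmod_map_comp (rfun_map g) (rfun_map f)).

Section RHomLeft.
Variables (L R : pzRingType) (M : rmodType R) (N : bimodType L R).

Definition rhom_scale (a : L) (f : rhom M N) : rhom M N :=
  RHom (rmod_map_comp (rmod_map_scale N a) (rfun_map f)).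

Fact rhom_scaleA a b f : rhom_scale a (rhom_scale b f) = rhom_scale (a * b) f.
Proof. by apply: rhom_ext => u /=; rewrite scalerA. Qed.
Fact rhom_scale1 : left_id 1 rhom_scale.
Proof. by move=> f; apply: rhom_ext => u /=; rewrite scale1r. Qed.
Fact rhom_scaleDr : right_distributive rhom_scale +%R.
Proof. by move=> a f g; apply: rhom_ext => u /=; rewrite scalerDr. Qed.
Fact rhom_scaleDl f : {morph rhom_scale^~ f : a b / a + b}.
Proof. by move=> a b; apply: rhom_ext => u /=; rewrite scalerDl. Qed.

HB.instance Definition _ := GRing.Zmodule_isLmodule.Build L (rhom M N)
  rhom_scaleA rhom_scale1 rhom_scaleDr rhom_scaleDl.

End RHomLeft.

Section RHomRight.
Variables (T R : pzRingType) (M : bimodType T R) (N : rmodType R).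

Definition rhom_ract (f : rhom M N) (t : T) : rhom M N :=
  RHom (rmod_map_comp (rfun_map f) (rmod_map_scale M t)).

Fact rhom_ractA f s t : rhom_ract (rhom_ract f s) t = rhom_ract f (s * t).
Proof. by apply: rhom_ext => u /=; rewrite scalerA. Qed.
Fact rhom_ract1 f : rhom_ract f 1 = f.
Proof. by apply: rhom_ext => u /=; rewrite scale1r. Qed.
Fact rhom_ractDl t : {morph rhom_ract^~ t : f g / f + g}.
Proof. by move=> f g; apply: rhom_ext. Qed.
Fact rhom_ractDr f : {morph rhom_ract f : s t / s + t}.
Proof. by move=> s t; apply: rhom_ext => u /=; rewrite scalerDl rhomD. Qed.

HB.instance Definition _ := Zmodule_isRmodule.Build T (rhom M N)
  rhom_ractA rhom_ract1 rhom_ractDl rhom_ractDr.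

End RHomRight.

Section RHomBimodule.
Variables (T L R : pzRingType) (M : bimodType T R) (N : bimodType L R).

Fact rhom_ractZ (a : L) (f : rhom M N) (t : T) : (a *: f) *< t = a *: (f *< t).
Proof. exact: rhom_ext. Qed.

HB.instance Definition _ := isBimodule.Build L T (rhom M N) rhom_ractZ.

Lemma rhom_scaleE (a : L) (f : rhom M N) u : (a *: f) u = a *: f u.
Proof. by []. Qed.
Lemma rhom_ractE (f : rhom M N) (t : T) u : (f *< t) u = f (t *: u).
Proof. by []. Qed.

End RHomBimodule.

Definition finitely_generated (R : pzRingType) (M : rmodType R) : Prop :=
  exists (n : nat) (e : 'I_n -> M),
    forall x, exists a : 'I_n -> R, x = \sum_(i < n) e i *< a i.

Definition projective (R : pzRingType) (M : rmodType R) : Prop :=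
  forall (X Y : rmodType R) (p : rhom X Y) (f : rhom M Y),
    (forall y, exists x, p x = y) -> exists g : rhom M X, forall m, p (g m) = f m.

Definition fg_projective (R : pzRingType) (M : rmodType R) : Prop :=
  finitely_generated M /\ projective M.

(* b lists the pairs (e*_i, e_i). *)
Definition is_dual_basis (R : pzRingType) (M : rmodType R)
    (b : seq (rhom M R^o * M)) : Prop :=
  forall x, x = \sum_(p <- b) p.2 *< (p.1 x : R).

Section FreeModule.
Variables (R : pzRingType) (n : nat).

Definition free_rmod : Type := {ffun 'I_n -> R}.
HB.instance Definition _ := GRing.Zmodule.on free_rmod.

Definition free_ract (v : free_rmod) (a : R) : free_rmod := [ffun i => v i * a].

Fact free_ractA v a b : free_ract (free_ract v a) b = free_ract v (a * b).
Proof. by apply/ffunP=> i; rewrite !ffunE mulrA. Qed.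
Fact free_ract1 v : free_ract v 1 = v.
Proof. by apply/ffunP=> i; rewrite !ffunE mulr1. Qed.
Fact free_ractDl a : {morph free_ract^~ a : u v / u + v}.
Proof. by move=> u v; apply/ffunP=> i; rewrite !ffunE mulrDl. Qed.
Fact free_ractDr v : {morph free_ract v : a b / a + b}.
Proof. by move=> a b; apply/ffunP=> i; rewrite !ffunE mulrDr. Qed.

HB.instance Definition _ := Zmodule_isRmodule.Build R free_rmod
  free_ractA free_ract1 free_ractDl free_ractDr.

Fact free_proj_map (i : 'I_n) : rmod_map (fun v : free_rmod => v i : R^o).
Proof. by split=> [u v|u a]; rewrite ffunE. Qed.

Definition free_proj i : rhom free_rmod R^o := RHom (free_proj_map i).

Variables (M : rmodType R) (e : 'I_n -> M).

Fact free_comb_map : rmod_map (fun v : free_rmod => \sum_(i < n) e i *< v i).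
Proof.
split=> [u v|u a].
  by rewrite -big_split; apply: eq_bigr => i _; rewrite ffunE ractDr.
rewrite (additive_map_sum _ _ (ractDl a)); apply: eq_bigr => i _.
by rewrite ffunE ractA.
Qed.

Definition free_comb : rhom free_rmod M := RHom free_comb_map.

End FreeModule.

Lemma dual_basis_exists (R : pzRingType) (M : rmodType R) :
  fg_projective M -> exists b : seq (rhom M R^o * M), is_dual_basis b.
Proof.
move=> [[n [e e_gen]] Mproj].
have [x|g gK] := Mproj _ _ (free_comb e) (rhom_id M).
  have [a ->] := e_gen x; exists ([ffun i => a i] : free_rmod R n).
  by apply: eq_bigr => i _; rewrite ffunE.
exists [seq (rhom_comp (free_proj R i) g, e i) | i <- enum 'I_n] => x.
by rewrite big_map big_enum -[LHS]gK.
Qed.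

Definition dual_basis (R : pzRingType) (M : rmodType R) (Mfgp : fg_projective M) :
    seq (rhom M R^o * M) :=
  sval (cid (dual_basis_exists Mfgp)).

Lemma dual_basisP (R : pzRingType) (M : rmodType R) (Mfgp : fg_projective M) :
  is_dual_basis (dual_basis Mfgp).
Proof. exact: svalP (cid (dual_basis_exists Mfgp)). Qed.

Section Corings.
Variables (K : comPzRingType) (A : kalgebra K).

Record coring := Coring {
  cor_car :> bimodType A A;
  cor_central : forall (k : K) (c : cor_car), kalg_in A k *: c = c *< kalg_in A k;
  cor_delta : cor_car -> tensor cor_car cor_car;
  cor_delta_map : bimod_map cor_delta;
  cor_eps : cor_car -> A^o;
  cor_eps_map : bimod_map cor_eps;
  cor_coassoc : forall c,
    tassoc (tmap cor_delta id (cor_delta c)) = tmap id cor_delta (cor_delta c);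
  cor_counitl : forall c, tlift (fun x y => (cor_eps x : A) *: y) (cor_delta c) = c;
  cor_counitr : forall c, tlift (fun x y => x *< (cor_eps y : A)) (cor_delta c) = c }.

Definition coring_map (C D : coring) (f : C -> D) : Prop :=
  [/\ bimod_map f,
      forall c, cor_delta (f c) = tmap f f (cor_delta c) &
      forall c, cor_eps (f c) = cor_eps c].

Definition coring_iso (C D : coring) (f : C -> D) : Prop :=
  coring_map f /\ exists g : D -> C, [/\ coring_map g, cancel f g & cancel g f].

End Corings.

Arguments cor_delta {K A} {_}.
Arguments cor_eps {K A} {_}.

Section Comodules.
Variables (K : comPzRingType) (A : kalgebra K) (C : coring A).

Record comodule := Comodule {
  com_car :> rmodType A;
  com_rho : com_car -> tensor com_car C;
  com_rho_map : rmod_map com_rho;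
  com_coassoc : forall m,
    tassoc (tmap com_rho id (com_rho m)) = tmap id cor_delta (com_rho m);
  com_counit : forall m,
    tlift (fun x c => x *< (cor_eps c : A)) (com_rho m) = m }.

Definition colinear (M N : comodule) (f : M -> N) : Prop :=
  forall m, com_rho (f m) = tmap f id (com_rho m).

Record comod_hom (M N : comodule) := ComodHom {
  chom :> rhom M N;
  chom_colinear : colinear chom }.

End Comodules.

Arguments com_rho {K A C} {_}.

Section TmapTheory.
Variables (S : pzRingType).
Implicit Types (M : rmodType S) (N : lmodType S).

Lemma tmap_id M N (x : tensor M N) : tmap id id x = x.
Proof.
elim/tensor_ind: x => [m n|x y IHx IHy]; first by rewrite tmap_pure.
by rewrite tmapD// IHx IHy.
Qed.

Lemma tmap_comp M M' M'' N N' N'' (f : M -> M') (f' : M' -> M'')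
    (g : N -> N') (g' : N' -> N'') x :
  rmod_map f -> rmod_map f' -> lmod_map g -> lmod_map g' ->
  tmap f' g' (tmap f g x) = tmap (fun m => f' (f m)) (fun n => g' (g n)) x.
Proof.
move=> fR f'R gL g'L; rewrite {2}/tmap tlift_comp; last exact: tmapD.
by apply: eq_tlift => m n; rewrite tmap_pure.
Qed.

Lemma eq_tmap M M' N N' (f f' : M -> M') (g g' : N -> N') x :
  f =1 f' -> g =1 g' -> tmap f g x = tmap f' g' x.
Proof. by move=> ff' gg'; apply: eq_tlift => m n; rewrite ff' gg'. Qed.

Lemma tmap0l M M' N N' (g : N -> N') x : tmap (fun _ : M => 0 : M') g x = 0.
Proof. by rewrite /tmap/tlift big1// => p _; rewrite tpure0l. Qed.

Lemma tmapDl M M' N N' (f f' : M -> M') (g : N -> N') x :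
  tmap (fun m => f m + f' m) g x = tmap f g x + tmap f' g x.
Proof. by apply: tlift_funD => m n; rewrite tpureDl. Qed.

Lemma tmapNl M M' N N' (f : M -> M') (g : N -> N') x :
  tmap (fun m => - f m) g x = - tmap f g x.
Proof.
apply/eqP; rewrite -addr_eq0 -tmapDl; apply/eqP; rewrite -[RHS](tmap0l _ g x).
by apply: eq_tmap => // m; rewrite addNr.
Qed.

End TmapTheory.

Section ComodHom.
Variables (K : comPzRingType) (A : kalgebra K) (C : coring A).

Section Additive.
Variables (M N : comodule C).

HB.instance Definition _ := gen_eqMixin (comod_hom M N).
HB.instance Definition _ := gen_choiceMixin (comod_hom M N).

Lemma comod_hom_ext (f g : comod_hom M N) : f =1 g -> f = g.
Proof.
case: f g => f fP [g gP] /= /(@rhom_ext _ _ _ f g) fg.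
by case: _ / fg in gP *; congr ComodHom; apply: Prop_irrelevance.
Qed.

Implicit Types f g : comod_hom M N.

Fact comod_zero_colinear : colinear (0 : rhom M N).
Proof.
by move=> m; rewrite tmap0l; apply: additive_map0; case: (com_rho_map N).
Qed.

Fact comod_opp_colinear f : colinear (- chom f).
Proof.
move=> m; rewrite rhomNE additive_mapN; last by case: (com_rho_map N).
by rewrite chom_colinear tmapNl.
Qed.

Fact comod_add_colinear f g : colinear (chom f + chom g).
Proof.
move=> m; rewrite rhomDE; case: (com_rho_map N) => -> _.
by rewrite !chom_colinear tmapDl.
Qed.

Definition comod_zero := ComodHom comod_zero_colinear.
Definition comod_opp f := ComodHom (@comod_opp_colinear f).
Definition comod_add f g := ComodHom (@comod_add_colinear f g).

Fact comod_addA : associative comod_add.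
Proof. by move=> f g h; apply: comod_hom_ext => u /=; rewrite addrA. Qed.
Fact comod_addC : commutative comod_add.
Proof. by move=> f g; apply: comod_hom_ext => u /=; rewrite addrC. Qed.
Fact comod_add0 : left_id comod_zero comod_add.
Proof. by move=> f; apply: comod_hom_ext => u /=; rewrite add0r. Qed.
Fact comod_addN : left_inverse comod_zero comod_opp comod_add.
Proof. by move=> f; apply: comod_hom_ext => u /=; rewrite addNr. Qed.

HB.instance Definition _ := GRing.isZmodule.Build (comod_hom M N)
  comod_addA comod_addC comod_add0 comod_addN.

End Additive.

Fact comod_id_colinear (M : comodule C) : colinear (rhom_id M).
Proof. by move=> m; rewrite tmap_id. Qed.

Definition comod_id (M : comodule C) : comod_hom M M :=
  ComodHom (@comod_id_colinear M).

Fact comod_comp_colinear (M N P : comodule C)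
    (g : comod_hom N P) (f : comod_hom M N) : colinear (rhom_comp g f).
Proof.
move=> m; rewrite /= !chom_colinear tmap_comp//; exact: rfun_map.
Qed.

Definition comod_comp (M N P : comodule C)
    (g : comod_hom N P) (f : comod_hom M N) : comod_hom M P :=
  ComodHom (@comod_comp_colinear M N P g f).

End ComodHom.

Record preadditive_cat := PreadditiveCat {
  cat_ob : Type;
  cat_hom : cat_ob -> cat_ob -> zmodType;
  cat_id : forall X, cat_hom X X;
  cat_comp : forall X Y Z, cat_hom Y Z -> cat_hom X Y -> cat_hom X Z;
  cat_compA : forall W X Y Z (h : cat_hom Y Z) (g : cat_hom X Y) (f : cat_hom W X),
    cat_comp h (cat_comp g f) = cat_comp (cat_comp h g) f;
  cat_comp1 : forall X Y (f : cat_hom X Y), cat_comp f (cat_id X) = f;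
  cat_1comp : forall X Y (f : cat_hom X Y), cat_comp (cat_id Y) f = f;
  cat_compDl : forall X Y Z (g h : cat_hom Y Z) (f : cat_hom X Y),
    cat_comp (g + h) f = cat_comp g f + cat_comp h f;
  cat_compDr : forall X Y Z (g : cat_hom Y Z) (f h : cat_hom X Y),
    cat_comp g (f + h) = cat_comp g f + cat_comp g h }.

Arguments cat_comp {p X Y Z}.

Section Abelian.
Variable D : preadditive_cat.
Local Notation ob := (cat_ob D).
Local Notation "X ~> Y" := (cat_hom X Y) (at level 70).
Local Notation "g \oc f" := (cat_comp g f) (at level 40, left associativity).

Definition zero_object (Z : ob) : Prop :=
  forall X, (exists! f : X ~> Z, True) /\ (exists! f : Z ~> X, True).

Definition is_product (X Y P : ob) (p : P ~> X) (q : P ~> Y) : Prop :=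
  forall W (f : W ~> X) (g : W ~> Y), exists! h : W ~> P, p \oc h = f /\ q \oc h = g.

Definition monic (X Y : ob) (f : X ~> Y) : Prop :=
  forall W (g h : W ~> X), f \oc g = f \oc h -> g = h.

Definition epic (X Y : ob) (f : X ~> Y) : Prop :=
  forall W (g h : Y ~> W), g \oc f = h \oc f -> g = h.

Definition is_kernel (X Y N : ob) (f : X ~> Y) (k : N ~> X) : Prop :=
  f \oc k = 0 /\ forall W (g : W ~> X), f \oc g = 0 -> exists! h : W ~> N, k \oc h = g.

Definition is_cokernel (X Y Q : ob) (f : X ~> Y) (c : Y ~> Q) : Prop :=
  c \oc f = 0 /\ forall W (g : Y ~> W), g \oc f = 0 -> exists! h : Q ~> W, h \oc c = g.

Record abelian : Prop := Abelian {
  ab_zero : exists Z, zero_object Z;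
  ab_prod : forall X Y, exists P (p : P ~> X) (q : P ~> Y), is_product p q;
  ab_ker : forall X Y (f : X ~> Y), exists N (k : N ~> X), is_kernel f k;
  ab_coker : forall X Y (f : X ~> Y), exists Q (c : Y ~> Q), is_cokernel f c;
  ab_mono : forall X Y (f : X ~> Y), monic f -> exists Z (g : Y ~> Z), is_kernel g f;
  ab_epi : forall X Y (f : X ~> Y), epic f -> exists Z (g : Z ~> X), is_cokernel g f }.

(* A generating set is given as a family indexed by a small type; the set
   itself may serve as index. *)
Definition generating (I : Type) (P : I -> ob) : Prop :=
  forall X Y (f g : X ~> Y), f <> g ->
    exists (i : I) (h : P i ~> X), f \oc h <> g \oc h.

End Abelian.

Section ComodCategory.
Variables (K : comPzRingType) (A : kalgebra K) (C : coring A).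

Implicit Types W X Y Z : comodule C.

Fact comod_compA W X Y Z (h : comod_hom Y Z) (g : comod_hom X Y)
    (f : comod_hom W X) :
  comod_comp h (comod_comp g f) = comod_comp (comod_comp h g) f.
Proof. exact: comod_hom_ext. Qed.
Fact comod_comp1 X Y (f : comod_hom X Y) : comod_comp f (comod_id X) = f.
Proof. exact: comod_hom_ext. Qed.
Fact comod_1comp X Y (f : comod_hom X Y) : comod_comp (comod_id Y) f = f.
Proof. exact: comod_hom_ext. Qed.
Fact comod_compDl X Y Z (g h : comod_hom Y Z) (f : comod_hom X Y) :
  comod_comp (g + h) f = comod_comp g f + comod_comp h f.
Proof. exact: comod_hom_ext. Qed.
Fact comod_compDr X Y Z (g : comod_hom Y Z) (f h : comod_hom X Y) :
  comod_comp g (f + h) = comod_comp g f + comod_comp g h.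
Proof. by apply: comod_hom_ext => u /=; rewrite rhomD. Qed.

Definition comod_cat : preadditive_cat :=
  PreadditiveCat comod_compA comod_comp1 comod_1comp comod_compDl comod_compDr.

Variable M : comodule C.

Definition comod_end : Type := comod_hom M M.
HB.instance Definition _ := GRing.Zmodule.on comod_end.

HB.instance Definition _ := GRing.Zmodule_isPzRing.Build comod_end
  (@comod_compA M M M M) (@comod_1comp M M) (@comod_comp1 M M)
  (fun s t u => comod_compDl s t u) (@comod_compDr M M M).

Definition comod_bimod : Type := M.
HB.instance Definition _ := Rmodule.on comod_bimod.

Definition comod_evact (t : comod_end) (u : comod_bimod) : comod_bimod :=
  (t : comod_hom M M) u.

Fact comod_evactA s t u : comod_evact s (comod_evact t u) = comod_evact (s * t) u.
Proof. by []. Qed.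
Fact comod_evact1 : left_id 1 comod_evact.
Proof. by []. Qed.
Fact comod_evactDr : right_distributive comod_evact +%R.
Proof. by move=> t u v; exact: (rhomD (t : comod_hom M M) u v). Qed.
Fact comod_evactDl u : {morph comod_evact^~ u : s t / s + t}.
Proof. by []. Qed.

HB.instance Definition _ := GRing.Zmodule_isLmodule.Build comod_end comod_bimod
  comod_evactA comod_evact1 comod_evactDr comod_evactDl.

Fact comod_evactZ (t : comod_end) (u : comod_bimod) (a : A) :
  (t *: u) *< a = t *: (u *< a).
Proof. by symmetry; exact: (rhomR (t : comod_hom M M) u a). Qed.

HB.instance Definition _ := isBimodule.Build comod_end A comod_bimod comod_evactZ.

Lemma comod_scaleE (t : comod_end) (u : comod_bimod) :
  t *: u = (t : comod_hom M M) u.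
Proof. by []. Qed.

End ComodCategory.

Section TmapTheory2.

Lemma tassoc_natural (S R : pzRingType) (M M' : rmodType S) (N N' : bimodType S R)
    (P P' : lmodType R) (f : M -> M') (g : N -> N') (h : P -> P') x :
  rmod_map f -> bimod_map g -> lmod_map h ->
  tassoc (tmap (tmap f g) h x) = tmap f (tmap g h) (tassoc x).
Proof.
move=> fR gB hL; have [gR gZ] := gB; have gL : lmod_map g by case: gR.
have fgR := tmap_rmod_map fR gB; have ghL := tmap_lmod_map gB hL.
elim/tensor_ind: x => [y p|x y IHx IHy]; last first.
  by rewrite (tmapD fgR hL) !tassocD (tmapD fR ghL) IHx IHy.
rewrite tmap_pure//; elim/tensor_ind: y => [m n|y z IHy IHz].
  by rewrite !tmap_pure// !tassoc_pure !tmap_pure.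
by rewrite (tmapD fR gL) !tpureDl !tassocD (tmapD fR ghL) IHy IHz.
Qed.

Lemma tlift_tmap (S : pzRingType) (M M' : rmodType S) (N N' : lmodType S)
    (V : zmodType) (h : M' -> N' -> V) (f : M -> M') (g : N -> N') x :
  balanced h -> rmod_map f -> lmod_map g ->
  tlift h (tmap f g x) = tlift (fun m n => h (f m) (g n)) x.
Proof.
move=> hB fR gL; rewrite /tmap tlift_comp; last exact: tliftD.
by apply: eq_tlift => m n; rewrite tlift_pure.
Qed.

Lemma counit_balanced (K : comPzRingType) (A : kalgebra K) (C : coring A)
    (M : rmodType A) : balanced (fun (m : M) (c : C) => m *< (cor_eps c : A)).
Proof.
have [[eD eR] eZ] := cor_eps_map C; split=> [c m n|m c d|m a c].
- by rewrite ractDl.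
- by rewrite eD ractDr.
- by rewrite eZ ractA.
Qed.

End TmapTheory2.

Section DirectSum.
Variables (R : pzRingType) (I : choiceType) (P : I -> rmodType R).

Record dsum := DSum {
  dcoef :> forall i, P i;
  dcoef_fin : exists s : seq I, forall i, i \notin s -> dcoef i = 0 }.

HB.instance Definition _ := gen_eqMixin dsum.
HB.instance Definition _ := gen_choiceMixin dsum.

Lemma dsum_ext (u v : dsum) : (forall i, u i = v i) -> u = v.
Proof.
case: u v => u uP [v vP] /= uv.
have {uv} : u = v by apply: functional_extensionality_dep.
move=> uv; by case: _ / uv in vP *; congr DSum; apply: Prop_irrelevance.
Qed.

Fact dsum_zero_fin : exists s : seq I, forall i, i \notin s -> 0 = 0 :> P i.
Proof. by exists [::]. Qed.

Fact dsum_opp_fin (u : dsum) :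
  exists s : seq I, forall i, i \notin s -> - u i = 0.
Proof.
by case: (dcoef_fin u) => s us; exists s => i /us ->; rewrite oppr0.
Qed.

Fact dsum_add_fin (u v : dsum) :
  exists s : seq I, forall i, i \notin s -> u i + v i = 0.
Proof.
case: (dcoef_fin u) (dcoef_fin v) => s us [t vt]; exists (s ++ t) => i.
by rewrite mem_cat negb_or => /andP[/us -> /vt ->]; rewrite addr0.
Qed.

Definition dsum_zero := DSum dsum_zero_fin.
Definition dsum_opp u := DSum (dsum_opp_fin u).
Definition dsum_add u v := DSum (dsum_add_fin u v).

Fact dsum_addA : associative dsum_add.
Proof. by move=> u v w; apply: dsum_ext => i /=; rewrite addrA. Qed.
Fact dsum_addC : commutative dsum_add.
Proof. by move=> u v; apply: dsum_ext => i /=; rewrite addrC. Qed.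
Fact dsum_add0 : left_id dsum_zero dsum_add.
Proof. by move=> u; apply: dsum_ext => i /=; rewrite add0r. Qed.
Fact dsum_addN : left_inverse dsum_zero dsum_opp dsum_add.
Proof. by move=> u; apply: dsum_ext => i /=; rewrite addNr. Qed.

HB.instance Definition _ := GRing.isZmodule.Build dsum
  dsum_addA dsum_addC dsum_add0 dsum_addN.

Fact dsum_ract_fin (u : dsum) (a : R) :
  exists s : seq I, forall i, i \notin s -> u i *< a = 0.
Proof.
case: (dcoef_fin u) => s us; exists s => i /us ->.
exact: (additive_map0 (ractDl a)).
Qed.

Definition dsum_ract u a := DSum (dsum_ract_fin u a).

Fact dsum_ractA u a b : dsum_ract (dsum_ract u a) b = dsum_ract u (a * b).
Proof. by apply: dsum_ext => i /=; rewrite ractA. Qed.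
Fact dsum_ract1 u : dsum_ract u 1 = u.
Proof. by apply: dsum_ext => i /=; rewrite ract1. Qed.
Fact dsum_ractDl a : {morph dsum_ract^~ a : u v / u + v}.
Proof. by move=> u v; apply: dsum_ext => i /=; rewrite ractDl. Qed.
Fact dsum_ractDr u : {morph dsum_ract u : a b / a + b}.
Proof. by move=> a b; apply: dsum_ext => i /=; rewrite ractDr. Qed.

HB.instance Definition _ := Zmodule_isRmodule.Build R dsum
  dsum_ractA dsum_ract1 dsum_ractDl dsum_ractDr.

Fact dsum_proj_map i : rmod_map (fun u : dsum => u i).
Proof. by []. Qed.

Definition dsum_proj i : rhom dsum (P i) := RHom (dsum_proj_map i).

Definition dsum_inj_coef i (x : P i) : forall j, P j :=
  dfwith (fun j => 0 : P j) x.

Fact dsum_inj_fin i (x : P i) :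
  exists s : seq I, forall j, j \notin s -> dsum_inj_coef x j = 0.
Proof.
exists [:: i] => j; rewrite inE => ji.
by rewrite /dsum_inj_coef dfwith_out// eq_sym.
Qed.

Definition dsum_inj_fun i (x : P i) := DSum (dsum_inj_fin x).

Fact dsum_inj_map i : rmod_map (@dsum_inj_fun i).
Proof.
split=> [x y|x a]; apply: dsum_ext => j /=; have [<-|ij] := eqVneq i j.
- by rewrite /dsum_inj_coef !dfwith_in.
- by rewrite /dsum_inj_coef !dfwith_out// addr0.
- by rewrite /dsum_inj_coef !dfwith_in.
- by rewrite /dsum_inj_coef !dfwith_out// (additive_map0 (ractDl a)).
Qed.

Definition dsum_inj i : rhom (P i) dsum := RHom (dsum_inj_map i).

Lemma dsum_injii i (x : P i) : dsum_inj i x i = x.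
Proof. exact: dfwith_in. Qed.

Lemma dsum_injij i j (x : P i) : i != j -> dsum_inj i x j = 0.
Proof. exact: dfwith_out. Qed.

Lemma dsum_proj_inj i (x : P i) : dsum_proj i (dsum_inj i x) = x.
Proof. exact: dsum_injii. Qed.

Lemma dsum_proj_inj0 i j (x : P i) : i != j -> dsum_proj j (dsum_inj i x) = 0.
Proof. exact: dsum_injij. Qed.

Definition dsum_supp (u : dsum) : seq I := undup (sval (cid (dcoef_fin u))).

Lemma dsum_suppP u i : i \notin dsum_supp u -> u i = 0.
Proof. by rewrite mem_undup; apply: svalP (cid (dcoef_fin u)) i. Qed.

(* The map u |-> \sum_i g i (u i) induced by a family of additive maps; by
   [dsum_liftE] any finite set outside which u vanishes can be summed over. *)
Definition dsum_lift (V : zmodType) (g : forall i, P i -> V) (u : dsum) : V :=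
  \sum_(i <- dsum_supp u) g i (u i).

Section Lift.
Variables (V : zmodType) (g : forall i, P i -> V).
Hypothesis gD : forall i, additive_map (@g i).

Lemma dsum_liftE (u : dsum) (s : seq I) : uniq s -> (forall i, i \notin s -> u i = 0) ->
  dsum_lift g u = \sum_(i <- s) g (u i).
Proof.
move=> s_uniq us; rewrite /dsum_lift.
have nz (t : seq I) : \sum_(i <- t) g (u i) =
    \sum_(i <- [seq i <- t | u i != 0]) g (u i).
  rewrite big_filter [RHS]big_rmcond// => i; rewrite negbK => /eqP ->.
  exact: additive_map0.
rewrite nz [RHS]nz; apply: perm_big; apply: uniq_perm.
- exact/filter_uniq/undup_uniq.
- exact: filter_uniq.
move=> i; rewrite !mem_filter; case: eqVneq => //= ui.
have -> : i \in s by apply: contraNT ui => /us ->.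
by apply: contraNT ui => /dsum_suppP ->.
Qed.

Lemma dsum_liftD : additive_map (dsum_lift g).
Proof.
move=> u v; set s := undup (dsum_supp u ++ dsum_supp v).
have s_uniq : uniq s by apply: undup_uniq.
have us i : i \notin s -> u i = 0.
  by rewrite mem_undup mem_cat negb_or => /andP[/dsum_suppP].
have vs i : i \notin s -> v i = 0.
  by rewrite mem_undup mem_cat negb_or => /andP[_ /dsum_suppP].
rewrite !(@dsum_liftE _ s)//; last first.
  by move=> i /[dup] /us /= -> /vs ->; rewrite addr0.
by rewrite -big_split; apply: eq_bigr => i _; apply: gD.
Qed.

Lemma dsum_lift_inj i (x : P i) : dsum_lift g (dsum_inj i x) = g x.
Proof.
rewrite (@dsum_liftE _ [:: i])//; last first.
  by move=> j; rewrite inE eq_sym => ij; rewrite dsum_injij.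
by rewrite big_seq1 dsum_injii.
Qed.

End Lift.

Lemma dsum_decomp (u : dsum) (s : seq I) : uniq s -> (forall i, i \notin s -> u i = 0) ->
  u = \sum_(i <- s) dsum_inj i (u i).
Proof.
move=> s_uniq us; apply: dsum_ext => j.
have -> : (\sum_(i <- s) dsum_inj i (u i)) j = \sum_(i <- s) dsum_inj i (u i) j.
  exact: (additive_map_sum _ _ (rhomD (dsum_proj j))).
have [js|js] := boolP (j \in s); last first.
  rewrite us// big_seq big1// => i i_s; apply: dsum_injij.
  by apply: contraNneq js => <-.
rewrite (bigD1_seq j)// dsum_injii big1; first exact/esym/addr0.
move=> i ij; exact: dsum_injij.
Qed.

Lemma dsum_ind (Q : dsum -> Prop) :
  Q 0 -> (forall i x, Q (dsum_inj i x)) -> (forall u v, Q u -> Q v -> Q (u + v)) ->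
  forall u, Q u.
Proof.
move=> Q0 Qi QD u.
rewrite (@dsum_decomp u (dsum_supp u)); [|exact: undup_uniq|exact: dsum_suppP].
exact: big_ind.
Qed.

Lemma dsum_lift_unique (V : zmodType) (f g : dsum -> V) :
  additive_map f -> additive_map g ->
  (forall i x, f (dsum_inj i x) = g (dsum_inj i x)) -> f =1 g.
Proof.
move=> fD gD fg; elim/dsum_ind => [|//|u v fu fv].
  by rewrite !additive_map0.
by rewrite fD gD fu fv.
Qed.

End DirectSum.

Section ComodCoproduct.
Variables (K : comPzRingType) (A : kalgebra K) (C : coring A).
Variables (I : choiceType) (P : I -> comodule C).

Local Notation DS := (dsum (fun i => com_car (P i))).
Local Notation inj i := (dsum_inj (fun j => com_car (P j)) i).

Definition coprod_rho : DS -> tensor DS C :=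
  dsum_lift (fun i x => tmap (inj i) (@id C) (com_rho x)).

Lemma coprod_rho_addl i :
  additive_map (fun x : P i => tmap (inj i) (@id C) (com_rho x)).
Proof.
move=> x y; case: (com_rho_map (P i)) => -> _.
by rewrite tmapD//; apply: rfun_map.
Qed.

Lemma coprod_rho_inj i (x : P i) :
  coprod_rho (inj i x) = tmap (inj i) (@id C) (com_rho x).
Proof. exact/(dsum_lift_inj coprod_rho_addl). Qed.

Lemma coprod_rhoD : additive_map coprod_rho.
Proof. exact/dsum_liftD/coprod_rho_addl. Qed.

Lemma id_bimod_map (L R : pzRingType) (U : bimodType L R) : bimod_map (@id U).
Proof. by []. Qed.

Fact coprod_rho_map : rmod_map coprod_rho.
Proof.
split=> [|u a]; first exact: coprod_rhoD.
elim/dsum_ind: u => [|i x|u v IHu IHv].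
- by rewrite (additive_map0 (ractDl a)) !(additive_map0 coprod_rhoD)
             (additive_map0 (ractDl a)).
- rewrite -rhomR !coprod_rho_inj; case: (com_rho_map (P i)) => _ ->.
  by case: (tmap_rmod_map (rfun_map (inj i)) (id_bimod_map C)) => _ ->.
- by rewrite ractDl !coprod_rhoD ractDl IHu IHv.
Qed.

Fact coprod_coassoc u :
  tassoc (tmap coprod_rho (@id C) (coprod_rho u)) =
  tmap id cor_delta (coprod_rho u).
Proof.
have rhoR := coprod_rho_map; have [dD dL] : lmod_map (@cor_delta _ _ C).
  by case: (cor_delta_map C) => -[].
have lhsD : additive_map (fun u =>
    tassoc (tmap coprod_rho (@id C) (coprod_rho u))).
  by move=> v w; rewrite coprod_rhoD tmapD// tassocD.
have rhsD : additive_map (fun u =>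
    tmap (@id DS) (@cor_delta _ _ C) (coprod_rho u)).
  by move=> v w; rewrite coprod_rhoD tmapD.
move: u; apply: (dsum_lift_unique lhsD rhsD) => i x.
have injR := rfun_map (inj i); have rhoiR := com_rho_map (P i).
rewrite coprod_rho_inj !tmap_comp//.
rewrite (@eq_tmap _ _ _ _ _ _ (fun y => tmap (inj i) (@id C) (com_rho y)) _ id)//;
  last exact: coprod_rho_inj.
rewrite -(@tmap_comp _ _ _ _ _ _ _ com_rho (tmap (inj i) (@id C)) id id)//;
  last exact: (tmap_rmod_map injR (id_bimod_map C)).
rewrite tassoc_natural// com_coassoc tmap_comp//.
  by apply: eq_tmap => // c; rewrite tmap_id.
exact: (tmap_lmod_map (id_bimod_map C) (lmod_map_id C)).
Qed.

Fact coprod_counit u :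
  tlift (fun v c => v *< (cor_eps c : A)) (coprod_rho u) = u.
Proof.
have lhsD : additive_map (fun u =>
    tlift (fun (v : DS) (c : C) => v *< (cor_eps c : A)) (coprod_rho u)).
  by move=> v w; rewrite coprod_rhoD (tliftD (counit_balanced _ _)).
move: u; apply: (dsum_lift_unique lhsD) => // i x.
have injR := rfun_map (inj i).
rewrite coprod_rho_inj tlift_tmap//; last exact: counit_balanced.
rewrite -[in RHS](com_counit x) (tlift_comp _ _ (rhomD (inj i))).
by apply: eq_tlift => m c; rewrite rhomR.
Qed.

Definition coprod_comod : comodule C :=
  Comodule coprod_rho_map coprod_coassoc coprod_counit.

Fact coprod_inj_colinear i :
  @colinear _ _ _ (P i) coprod_comod (inj i).
Proof. exact: coprod_rho_inj. Qed.

Definition coprod_inj i : comod_hom (P i) coprod_comod :=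
  ComodHom (@coprod_inj_colinear i).

Fact coprod_proj_colinear i :
  @colinear _ _ _ coprod_comod (P i) (dsum_proj (fun j => com_car (P j)) i).
Proof.
have [rhoD _] := com_rho_map (P i).
apply: dsum_lift_unique => [u v|u v|j x].
- by rewrite rhomD rhoD.
- by rewrite [com_rho _]coprod_rhoD tmapD//; apply: rfun_map.
have -> : com_rho (inj j x : coprod_comod) = tmap (inj j) (@id C) (com_rho x).
  exact: coprod_rho_inj.
rewrite tmap_comp//; try exact: rfun_map.
have [ij|ij] := eqVneq j i.
  move: x; case: i / ij rhoD => rhoD x.
  rewrite dsum_proj_inj -[LHS]tmap_id; apply: eq_tmap => // y.
  by rewrite dsum_proj_inj.
rewrite dsum_proj_inj0// (additive_map0 rhoD) -[LHS](tmap0l _ (@id C) (com_rho x)).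
by apply: eq_tmap => // y; rewrite dsum_proj_inj0.
Qed.

Definition coprod_proj i : comod_hom coprod_comod (P i) :=
  ComodHom (@coprod_proj_colinear i).

End ComodCoproduct.

Section Comatrix.
Variables (K : comPzRingType) (A : kalgebra K) (C : coring A).
Variables (I : choiceType) (P : I -> comodule C).
Hypothesis Pfgp : forall i, fg_projective (P i).

Local Notation Sigma := (coprod_comod P).
Local Notation T := (comod_end Sigma).
Local Notation SB := (comod_bimod Sigma).
Local Notation Sdual := (rhom SB A^o).
Local Notation inj i := (coprod_inj P i).
Local Notation proj i := (coprod_proj P i).

Definition comatrix : bimodType A A := tensor Sdual SB.

Definition coprod_idem i : T := comod_comp (inj i) (proj i).

Definition comatrix_term (phi : Sdual) i (x : P i) : tensor comatrix comatrix :=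
  \sum_(p <- dual_basis (Pfgp i))
    ((rhom_comp phi (rhom_comp (inj i) (proj i)) : Sdual) \ox (inj i p.2 : SB)
       : comatrix)
    \ox ((rhom_comp p.1 (proj i) : Sdual) \ox (inj i x : SB) : comatrix).

(* Here [dsum_lift] sums the terms of index i and argument x = pi_i(u) over the
   support of u; see [comatrix_delta_pure] for the resulting formula. *)
Definition comatrix_delta : comatrix -> tensor comatrix comatrix :=
  tlift (fun (phi : Sdual) (u : SB) =>
    dsum_lift (fun i x => comatrix_term phi x) (u : Sigma)).

Definition comatrix_eps : comatrix -> A^o :=
  tlift (fun (phi : Sdual) (u : SB) => phi u).

Lemma comatrix_termDr phi i : additive_map (@comatrix_term phi i).
Proof.
move=> x y; rewrite /comatrix_term -big_split; apply: eq_bigr => p _.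
by rewrite (rhomD (inj i)) tpureDr tpureDr.
Qed.

Lemma comatrix_termDl phi psi i (x : P i) :
  comatrix_term (phi + psi) x = comatrix_term phi x + comatrix_term psi x.
Proof.
rewrite /comatrix_term -big_split; apply: eq_bigr => p _.
rewrite -[RHS]tpureDl -[X in _ = X \ox _]tpureDl; congr (_ \ox _ \ox _); exact: rhom_ext.
Qed.

Lemma coprod_idemE i (u : SB) : coprod_idem i *: u = inj i (proj i u).
Proof. by []. Qed.

Lemma comatrix_termE phi i (u : SB) :
  comatrix_term phi (proj i u) =
  \sum_(p <- dual_basis (Pfgp i)) (phi \ox (inj i p.2 : SB) : comatrix)
     \ox ((rhom_comp p.1 (proj i) : Sdual) \ox u : comatrix).
Proof.
rewrite /comatrix_term; apply: eq_bigr => p _.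
have -> : (rhom_comp phi (rhom_comp (inj i) (proj i)) : Sdual)
    = phi *< coprod_idem i by apply: rhom_ext.
rewrite tpureA [coprod_idem i *: _]/(inj i (proj i (inj i p.2))).
rewrite -[inj i (proj i u)]/(coprod_idem i *: u) -tpureA.
congr (_ \ox _ \ox (_ \ox _)).
  by congr (inj i _); exact: dsum_proj_inj.
apply: rhom_ext => v /=; congr (p.1 _).
exact: dsum_proj_inj.
Qed.

Lemma comatrix_deltaDr phi :
  additive_map (dsum_lift (fun i (x : P i) => comatrix_term phi x)).
Proof. exact/dsum_liftD/comatrix_termDr. Qed.

Lemma comatrix_delta_inj phi i (x : P i) :
  dsum_lift (fun i (x : P i) => comatrix_term phi x) (inj i x) = comatrix_term phi x.
Proof. exact/(dsum_lift_inj (comatrix_termDr phi)). Qed.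

Lemma dual_basis_map (i : I) (f : Sdual) (t : T) :
  \sum_(p <- dual_basis (Pfgp i))
     (f (t *: (inj i p.2 : SB)) : A) *: (rhom_comp p.1 (proj i) : Sdual) =
  (f *< t) *< coprod_idem i.
Proof.
apply: rhom_ext => u; rewrite rhom_sumE.
transitivity (f (t *: (inj i (proj i u) : SB))); last by [].
rewrite [in RHS](dual_basisP (Pfgp i) (proj i u)).
rewrite (additive_map_sum _ _ (rhomD (inj i))) scaler_sumr.
rewrite (additive_map_sum _ _ (rhomD f)); apply: eq_bigr => p _.
by rewrite rhomR -ractZ rhomR.
Qed.

Lemma comatrix_deltaT phi (t : T) (u : SB) :
  dsum_lift (fun i (x : P i) => comatrix_term (phi *< t) x) (u : Sigma) =
  dsum_lift (fun i (x : P i) => comatrix_term phi x) (t *: u : Sigma).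
Proof.
have rhsD : additive_map (fun u : SB =>
    dsum_lift (fun i (x : P i) => comatrix_term phi x) (t *: u : Sigma)).
  by move=> v w; rewrite scalerDr; apply: comatrix_deltaDr.
move: u; apply: (dsum_lift_unique (comatrix_deltaDr _) rhsD) => i x.
rewrite comatrix_delta_inj; set b := dual_basis (Pfgp i).
pose y : SB := t *: (inj i x : SB).
pose s := undup (dsum_supp (y : Sigma) ++
  flatten [seq dsum_supp (t *: (inj i p.2 : SB) : Sigma) | p <- b]).
have s_uniq : uniq s by apply: undup_uniq.
have ys j : j \notin s -> (y : Sigma) j = 0.
  by rewrite mem_undup mem_cat negb_or => /andP[/dsum_suppP].
have bs p : p \in b -> forall j, j \notin s -> (t *: (inj i p.2 : SB) : Sigma) j = 0.
  move=> pb j js; apply: dsum_suppP; apply: contra js => js.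
  rewrite mem_undup mem_cat; apply/orP; right; apply/flattenP.
  by exists (dsum_supp (t *: (inj i p.2 : SB) : Sigma)) => //; apply: map_f.
rewrite (dsum_liftE (comatrix_termDr phi) s_uniq ys).
rewrite -{1}[x](dsum_proj_inj (P := fun i => com_car (P i))).
rewrite (comatrix_termE _ _ (inj i x : SB)).
pose a (p : rhom (P i) A^o * P i) j (q : rhom (P j) A^o * P j) : A :=
  q.1 (proj j (t *: (inj i p.2 : SB))).
transitivity (\sum_(j <- s) \sum_(q <- dual_basis (Pfgp j)) \sum_(p <- b)
   (phi \ox (inj j q.2 : SB) : comatrix) \ox
   (a p j q *: ((rhom_comp p.1 (proj i) : Sdual) \ox (inj i x : SB)) : comatrix)).
  under [RHS]eq_bigr do rewrite exchange_big.
  rewrite [RHS]exchange_big /=; apply: eq_big_seq => p pb.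
  rewrite tpureA [X in phi \ox X](dsum_decomp s_uniq (bs p pb)).
  rewrite tpure_sumr tpure_suml; apply: eq_bigr => j _.
  rewrite [X in inj j X](dual_basisP (Pfgp j)).
  rewrite (additive_map_sum _ _ (rhomD (inj j))) tpure_sumr tpure_suml.
  by apply: eq_bigr => q _; rewrite rhomR -ract_pure tpureA.
apply: eq_bigr => j _; rewrite (comatrix_termE phi j y).
apply: eq_bigr => q _; rewrite -tpure_sumr; congr (_ \ox _).
under eq_bigr do rewrite scale_pure.
rewrite -tpure_suml (dual_basis_map i (rhom_comp q.1 (proj j)) t).
rewrite !tpureA; congr (_ \ox (t *: _)).
by congr (inj i _); apply: dsum_proj_inj.
Qed.

Lemma comatrix_delta_balanced : balanced (fun (phi : Sdual) (u : SB) =>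
  dsum_lift (fun i (x : P i) => comatrix_term phi x) (u : Sigma)).
Proof.
split=> [u phi psi|phi u v|phi t u]; last exact: comatrix_deltaT.
  rewrite /dsum_lift -big_split; apply: eq_bigr => i _; exact: comatrix_termDl.
exact: comatrix_deltaDr.
Qed.

Lemma comatrix_deltaD : additive_map comatrix_delta.
Proof. exact/tliftD/comatrix_delta_balanced. Qed.

Lemma comatrix_delta_pure_inj phi i (x : P i) :
  comatrix_delta ((phi : Sdual) \ox (inj i x : SB)) = comatrix_term phi x.
Proof.
by rewrite /comatrix_delta (tlift_pure comatrix_delta_balanced) comatrix_delta_inj.
Qed.

(* An arbitrary finite set F of indices with u = \sum_(P in F) iota_P pi_P u
   can be used to compute the comultiplication. *)
Lemma comatrix_delta_pure (phi : Sdual) (u : SB) (F : seq I) :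
  uniq F -> u = \sum_(i <- F) (inj i (proj i u) : SB) ->
  comatrix_delta (phi \ox u) = \sum_(i <- F) comatrix_term phi (proj i u).
Proof.
move=> F_uniq uF; rewrite /comatrix_delta (tlift_pure comatrix_delta_balanced).
apply: (dsum_liftE (comatrix_termDr phi)) => // i iF.
transitivity (proj i u); first by [].
rewrite uF (additive_map_sum _ _ (rhomD (proj i))).
rewrite big_seq big1// => j jF; apply: dsum_proj_inj0.
by apply: contraNneq iF => <-.
Qed.

Lemma comatrix_ind (Q : comatrix -> Prop) : Q 0 ->
  (forall (phi : Sdual) i (x : P i), Q (phi \ox (inj i x : SB))) ->
  (forall c d, Q c -> Q d -> Q (c + d)) -> forall c, Q c.
Proof.
move=> Q0 Qi QD; elim/tensor_ind => // phi; elim/dsum_ind => [|i x|u v Qu Qv].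
- by rewrite tpure0r.
- exact: Qi.
- by rewrite tpureDr; apply: QD.
Qed.

End Comatrix.

Section ComatrixCoring.
Variables (K : comPzRingType) (A : kalgebra K) (C : coring A).
Variables (I : choiceType) (P : I -> comodule C).
Hypothesis Pfgp : forall i, fg_projective (P i).

Local Notation Sigma := (coprod_comod P).
Local Notation T := (comod_end Sigma).
Local Notation SB := (comod_bimod Sigma).
Local Notation Sdual := (rhom SB A^o).
Local Notation inj i := (coprod_inj P i).
Local Notation proj i := (coprod_proj P i).
Local Notation comatrix := (comatrix P).
Local Notation delta := (comatrix_delta Pfgp).
Local Notation eps := (@comatrix_eps _ _ _ _ P).
Local Notation term phi x := (comatrix_term Pfgp phi x).

Lemma comatrix_eps_balanced : balanced (fun (phi : Sdual) (u : SB) => phi u).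
Proof. by split=> [u phi psi|phi u v|phi t u] //; apply: rhomD. Qed.

Lemma comatrix_eps_pure (phi : Sdual) (u : SB) : eps (phi \ox u) = phi u.
Proof. exact: (tlift_pure comatrix_eps_balanced). Qed.

Lemma comatrix_epsD : additive_map eps.
Proof. exact/tliftD/comatrix_eps_balanced. Qed.

Fact comatrix_eps_map : bimod_map eps.
Proof.
split; first split=> [|x a]; first exact: comatrix_epsD.
  elim/tensor_ind: x => [phi u|x y IHx IHy].
    by rewrite ract_pure !comatrix_eps_pure rhomR.
  by rewrite ractDl !comatrix_epsD ractDl IHx IHy.
move=> a x; elim/tensor_ind: x => [phi u|x y IHx IHy].
  by rewrite scale_pure !comatrix_eps_pure.
by rewrite scalerDr !comatrix_epsD scalerDr IHx IHy.
Qed.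

Fact comatrix_delta_map : bimod_map delta.
Proof.
have dD := comatrix_deltaD Pfgp; split; first split=> // [x a].
  elim/comatrix_ind: x => [|phi i x|x y IHx IHy].
  - by rewrite (additive_map0 (ractDl a)) !(additive_map0 dD)
               (additive_map0 (ractDl a)).
  - rewrite ract_pure.
    have -> : (inj i x : SB) *< a = inj i (x *< a) by symmetry; apply: rhomR.
    rewrite !comatrix_delta_pure_inj /comatrix_term.
    rewrite (additive_map_sum _ _ (ractDl a)); apply: eq_bigr => p _.
    by rewrite !ract_pure (rhomR (inj i)).
  - by rewrite ractDl !dD ractDl IHx IHy.
move=> a x; elim/comatrix_ind: x => [|phi i x|x y IHx IHy].
- by rewrite scaler0 (additive_map0 dD) scaler0.
- rewrite scale_pure !comatrix_delta_pure_inj /comatrix_term scaler_sumr.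
  apply: eq_bigr => p _; rewrite !scale_pure.
  by congr (_ \ox _ \ox _); apply: rhom_ext.
- by rewrite scalerDr !dD scalerDr IHx IHy.
Qed.

Lemma comatrix_dual_sum (i : I) (phi : Sdual) :
  \sum_(p <- dual_basis (Pfgp i))
     (phi (inj i p.2) : A) *: (rhom_comp p.1 (proj i) : Sdual) =
  phi *< coprod_idem P i.
Proof. by have := dual_basis_map Pfgp i phi 1; rewrite ract1 => <-. Qed.

Lemma coprod_projK i (x : P i) : proj i (inj i x) = x.
Proof. exact: dsum_proj_inj. Qed.

Fact comatrix_coassoc c :
  tassoc (tmap delta id (delta c)) = tmap id delta (delta c).
Proof.
have dD := comatrix_deltaD Pfgp; have [dR dZ] := comatrix_delta_map.
have dL : lmod_map delta by [].
elim/comatrix_ind: c => [|phi i x|c d IHc IHd]; last first.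
- by rewrite dD (tmapD dR)// (tmapD _ dL)// tassocD IHc IHd.
- rewrite comatrix_delta_pure_inj /comatrix_term.
  rewrite (additive_map_sum _ _ (tmapD dR (lmod_map_id _))).
  rewrite (additive_map_sum _ _ (tmapD (rmod_map_id _) dL)).
  rewrite (additive_map_sum _ _ (@tassocD _ _ _ _ _)).
  under eq_bigr do rewrite (tmap_pure dR (lmod_map_id _)) comatrix_delta_pure_inj
    /comatrix_term tpure_suml (additive_map_sum _ _ (@tassocD _ _ _ _ _)).
  under [RHS]eq_bigr do rewrite (tmap_pure (rmod_map_id _) dL) comatrix_delta_pure_inj
    /comatrix_term tpure_sumr.
  rewrite exchange_big; apply: eq_bigr => p _; apply: eq_bigr => q _ /=.
  rewrite tassoc_pure; congr (_ \ox _ \ox (_ \ox _ \ox _)).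
    by apply: rhom_ext => u /=; congr (phi (inj i _)); apply: coprod_projK.
  by apply: rhom_ext => u /=; congr (p.1 _); symmetry; apply: coprod_projK.
- rewrite (additive_map0 dD) (additive_map0 (tmapD dR _))//.
  by rewrite (additive_map0 (tmapD _ dL))// (additive_map0 (@tassocD _ _ _ _ _)).
Qed.

Lemma counitl_balanced : balanced (fun x y : comatrix => (eps x : A) *: y).
Proof.
have [[eD eR] eZ] := comatrix_eps_map; split=> [n x y|x m n|x a y].
- by rewrite eD scalerDl.
- by rewrite scalerDr.
- by rewrite eR -scalerA.
Qed.

Lemma counitr_balanced : balanced (fun x y : comatrix => x *< (eps y : A)).
Proof.
have [[eD eR] eZ] := comatrix_eps_map; split=> [n x y|x m n|x a y].
- by rewrite ractDl.
- by rewrite eD ractDr.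
- by rewrite eZ ractA.
Qed.

Lemma idem_inj (phi : Sdual) i (x : P i) :
  (rhom_comp phi (rhom_comp (inj i) (proj i)) : Sdual) \ox (inj i x : SB) =
  phi \ox (inj i x : SB) :> comatrix.
Proof.
have -> : (rhom_comp phi (rhom_comp (inj i) (proj i)) : Sdual)
    = phi *< coprod_idem P i by apply: rhom_ext.
rewrite tpureA; congr (_ \ox _).
by congr (inj i _); apply: coprod_projK.
Qed.

Fact comatrix_counitl c : tlift (fun x y => (eps x : A) *: y) (delta c) = c.
Proof.
have dD := comatrix_deltaD Pfgp; have cD := tliftD counitl_balanced.
elim/comatrix_ind: c => [|phi i x|c d IHc IHd]; last first.
- by rewrite dD cD IHc IHd.
- rewrite comatrix_delta_pure_inj /comatrix_term (additive_map_sum _ _ cD).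
  under eq_bigr do rewrite (tlift_pure counitl_balanced) idem_inj
    comatrix_eps_pure scale_pure.
  rewrite -tpure_suml comatrix_dual_sum.
  by rewrite -[RHS]idem_inj; congr (_ \ox _); apply: rhom_ext.
- by rewrite (additive_map0 dD) (additive_map0 cD).
Qed.

Fact comatrix_counitr c : tlift (fun x y => x *< (eps y : A)) (delta c) = c.
Proof.
have dD := comatrix_deltaD Pfgp; have cD := tliftD counitr_balanced.
elim/comatrix_ind: c => [|phi i x|c d IHc IHd]; last first.
- by rewrite dD cD IHc IHd.
- rewrite comatrix_delta_pure_inj /comatrix_term (additive_map_sum _ _ cD).
  under eq_bigr do rewrite (tlift_pure counitr_balanced) idem_inj
    comatrix_eps_pure ract_pure.
  rewrite -tpure_sumr; congr (_ \ox _).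
  transitivity (\sum_(p <- dual_basis (Pfgp i)) inj i (p.2 *< (p.1 x : A))).
    apply: eq_bigr => p _; rewrite [RHS](rhomR (inj i)).
    by congr (_ *< _); congr (p.1 _); apply: coprod_projK.
  by rewrite -(additive_map_sum _ _ (rhomD (inj i))) -(dual_basisP (Pfgp i)).
- by rewrite (additive_map0 dD) (additive_map0 cD).
Qed.

Section Central.
Variable k : K.
Local Notation z := (kalg_in A k).

Fact central_map : rmod_map (fun u : Sigma => u *< z).
Proof.
by split=> [u v|u a]; rewrite ?ractDl// !ractA kalg_inC.
Qed.

Definition central_hom : rhom Sigma Sigma := RHom central_map.

Fact central_colinear : @colinear _ _ _ Sigma Sigma central_hom.
Proof.
move=> u; transitivity (com_rho u *< z); first exact: (proj2 (com_rho_map Sigma)).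
elim/tensor_ind: (com_rho u) => [v c|x y IHx IHy].
  by rewrite ract_pure -cor_central -tpureA (tmap_pure central_map (lmod_map_id _)).
by rewrite ractDl IHx IHy (tmapD central_map (lmod_map_id _)).
Qed.

Definition central_end : T := ComodHom central_colinear.

End Central.

Fact comatrix_central (k : K) (c : comatrix) : kalg_in A k *: c = c *< kalg_in A k.
Proof.
elim/tensor_ind: c => [phi u|x y IHx IHy]; last by rewrite scalerDr ractDl IHx IHy.
rewrite scale_pure ract_pure -[u *< _]/(central_end k *: u) -tpureA.
congr (_ \ox _); apply: rhom_ext => v; rewrite rhom_scaleE rhom_ractE.
rewrite [central_end k *: v]/(v *< kalg_in A k) rhomR.
exact: kalg_inC.
Qed.

Definition comatrix_coring : coring A :=
  Coring comatrix_central comatrix_delta_map comatrix_eps_map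
    comatrix_coassoc comatrix_counitl comatrix_counitr.

Definition comatrix_can : comatrix_coring -> C :=
  tlift (fun (phi : Sdual) (u : SB) =>
    tlift (fun (v : Sigma) (c : C) => (phi v : A) *: c) (com_rho (u : Sigma))).

Lemma comatrix_can_balanced1 (phi : Sdual) :
  balanced (fun (v : Sigma) (c : C) => (phi v : A) *: c).
Proof.
split=> [c u v|u c d|u a c].
- by rewrite (rhomD phi) scalerDl.
- by rewrite scalerDr.
- by rewrite (rhomR phi) -scalerA.
Qed.

Lemma comatrix_can_balanced : balanced (fun (phi : Sdual) (u : SB) =>
  tlift (fun (v : Sigma) (c : C) => (phi v : A) *: c) (com_rho (u : Sigma))).
Proof.
have [rhoD _] := com_rho_map Sigma; split=> [u phi psi|phi u v|phi t u].
- by apply: tlift_funD => v c; rewrite rhomDE scalerDl.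
- by rewrite [com_rho _]rhoD (tliftD (comatrix_can_balanced1 phi)).
- have -> : com_rho (t *: u : Sigma) = tmap t id (com_rho (u : Sigma)).
    exact: (chom_colinear t).
  rewrite tlift_tmap//; [exact: comatrix_can_balanced1|exact: rfun_map].
Qed.

Lemma comatrix_can_pure (phi : Sdual) (u : SB) : comatrix_can (phi \ox u) =
  tlift (fun (v : Sigma) (c : C) => (phi v : A) *: c) (com_rho (u : Sigma)).
Proof. exact: (tlift_pure comatrix_can_balanced). Qed.

End ComatrixCoring.

Arguments comatrix_coring {K A C I P} Pfgp.
Arguments comatrix_can {K A C I P} Pfgp.

(* Main.v *)
(* A colinear map P -> C is the same thing as an A-linear form on P, so there is a
   colinear map h from G, a coproduct of copies of the P in the generating set
   indexed by pairs of P and a form on Sigma, to C through which every colinear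
   P -> C factors, and h = can theta for a surjection theta from G onto
   Sigma^* (x)_T Sigma.  Since the P generate, h is an epimorphism, hence a
   surjection, because cokernels of comodules are computed in A-modules; thus can
   is surjective.  Since the category is abelian, h is the cokernel of some
   g : Z -> G, and for the same reason Ker h = Im g as A-modules (monomorphisms of
   comodules are never compared with injections; flatness of C does not enter).
   Every element of Z is a sum of elements in the image of maps P -> Z, so it
   remains to see that theta kills the image of any e : P -> G with h e = 0;
   this is where finite generation of P and the endomorphisms in T are used. *)

Require Import Defs.
From HB Require Import structures.
From mathcomp Require Import all_boot all_algebra.
From mathcomp Require Import boolp.

Set Implicit Arguments.
Unset Strict Implicit.
Unset Printing Implicit Defensive.

Import GRing.Theory.
Local Open Scope ring_scope.
Local Open Scope quotient_scope.

(** * Quotients of right modules *)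

Section QuotientModule.
Variables (R : pzRingType) (M : rmodType R).

Record rsubmod := RSubmod {
  rsub_mem :> M -> Prop;
  rsub0 : rsub_mem 0;
  rsubD : forall u v, rsub_mem u -> rsub_mem v -> rsub_mem (u + v);
  rsubR : forall u a, rsub_mem u -> rsub_mem (u *< a) }.

Variable W : rsubmod.

Lemma rsubN u : W u -> W (- u).
Proof. by move=> /(rsubR (-1)); rewrite (additive_mapN _ (ractDr u)) ract1. Qed.

Definition rquot_rel : rel M := fun u v => `[< W (u - v) >].

Lemma rquot_rel_refl : reflexive rquot_rel.
Proof. by move=> u; apply/asboolP; rewrite subrr; apply: rsub0. Qed.

Lemma rquot_rel_sym : symmetric rquot_rel.
Proof. by move=> u v; apply/asboolP/asboolP => /rsubN; rewrite opprB. Qed.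

Lemma rquot_rel_trans : transitive rquot_rel.
Proof.
move=> v u w /asboolP uv /asboolP vw; apply/asboolP.
by rewrite -(subrKA v); apply: rsubD.
Qed.

Canonical rquot_equiv := EquivRel rquot_rel rquot_rel_refl rquot_rel_sym rquot_rel_trans.

Definition rquot : Type := {eq_quot rquot_equiv}.
HB.instance Definition _ := Choice.on rquot.
HB.instance Definition _ := Quotient.on rquot.

Definition rquot_class (u : M) : rquot := \pi_rquot u.

Lemma rquot_classP u v : rquot_class u = rquot_class v <-> W (u - v).
Proof. by split=> [/eqmodP/asboolP|uv]; last exact/eqmodP/asboolP. Qed.

Lemma rquot_classK (x : rquot) : rquot_class (repr x) = x.
Proof. exact: reprK. Qed.

Lemma rquot_ind (Q : rquot -> Prop) : (forall u, Q (rquot_class u)) -> forall x, Q x.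
Proof. by move=> Qc x; rewrite -(rquot_classK x). Qed.

Lemma rquot_repr u : W (repr (rquot_class u) - u).
Proof. by apply/rquot_classP; apply: rquot_classK. Qed.

Definition rquot_add (x y : rquot) : rquot := rquot_class (repr x + repr y).
Definition rquot_opp (x : rquot) : rquot := rquot_class (- repr x).
Definition rquot_ract (x : rquot) (a : R) : rquot := rquot_class (repr x *< a).

Lemma rquot_addE u v :
  rquot_add (rquot_class u) (rquot_class v) = rquot_class (u + v).
Proof. by apply/rquot_classP; rewrite opprD addrACA; apply: rsubD; apply: rquot_repr. Qed.

Lemma rquot_oppE u : rquot_opp (rquot_class u) = rquot_class (- u).
Proof. by apply/rquot_classP; rewrite -opprD; apply/rsubN/rquot_repr. Qed.

Lemma rquot_ractE u a : rquot_ract (rquot_class u) a = rquot_class (u *< a).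
Proof.
apply/rquot_classP; rewrite -(additive_mapN _ (ractDl a)) -ractDl.
exact/rsubR/rquot_repr.
Qed.

Fact rquot_addA : associative rquot_add.
Proof.
by elim/rquot_ind=> u; elim/rquot_ind=> v; elim/rquot_ind=> w; rewrite !rquot_addE addrA.
Qed.
Fact rquot_addC : commutative rquot_add.
Proof. by elim/rquot_ind=> u; elim/rquot_ind=> v; rewrite !rquot_addE addrC. Qed.
Fact rquot_add0 : left_id (rquot_class 0) rquot_add.
Proof. by elim/rquot_ind=> u; rewrite rquot_addE add0r. Qed.
Fact rquot_addN : left_inverse (rquot_class 0) rquot_opp rquot_add.
Proof. by elim/rquot_ind=> u; rewrite rquot_oppE rquot_addE addNr. Qed.

HB.instance Definition _ := GRing.isZmodule.Build rquot
  rquot_addA rquot_addC rquot_add0 rquot_addN.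

Lemma rquot_classD : additive_map rquot_class.
Proof. by move=> u v; rewrite -rquot_addE. Qed.

Fact rquot_ractA x a b : rquot_ract (rquot_ract x a) b = rquot_ract x (a * b).
Proof. by elim/rquot_ind: x => u; rewrite !rquot_ractE ractA. Qed.
Fact rquot_ract1 x : rquot_ract x 1 = x.
Proof. by elim/rquot_ind: x => u; rewrite rquot_ractE ract1. Qed.
Fact rquot_ractDl a : {morph rquot_ract^~ a : x y / x + y}.
Proof.
elim/rquot_ind=> u; elim/rquot_ind=> v /=.
by rewrite -rquot_classD !rquot_ractE ractDl rquot_classD.
Qed.
Fact rquot_ractDr x : {morph rquot_ract x : a b / a + b}.
Proof.
by elim/rquot_ind: x => u a b /=; rewrite !rquot_ractE ractDr rquot_classD.
Qed.

HB.instance Definition _ := Zmodule_isRmodule.Build R rquot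
  rquot_ractA rquot_ract1 rquot_ractDl rquot_ractDr.

Fact rquot_proj_map : rmod_map rquot_class.
Proof. by split=> [|u a]; [apply: rquot_classD | rewrite -rquot_ractE]. Qed.

Definition rquot_proj : rhom M rquot := RHom rquot_proj_map.

Lemma rquot_proj_eq0 u : rquot_proj u = 0 <-> W u.
Proof. by rewrite -[in X in _ <-> X](subr0 u); apply: rquot_classP. Qed.

End QuotientModule.

Section Comodules.
Variables (K : comPzRingType) (A : kalgebra K) (C : coring A).

(** * Quotients of comodules *)

Section QuotientComodule.
Variables (X : comodule C) (W : rsubmod X).
Local Notation pr := (rquot_proj W).
(** This is what lets the coaction descend to [X/W]. It is stated in [(X/W) (x) C] because
    [W (x) C -> X (x) C] may fail to be injective. *)
Hypothesis W_sub : forall x, W x -> tmap pr (@id C) (com_rho x) = 0.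

Let rho_pr x : tensor (rquot W) C := tmap pr (@id C) (com_rho x).

Let rho_pr_map : rmod_map rho_pr.
Proof.
exact: rmod_map_comp (tmap_rmod_map (rfun_map pr) (id_bimod_map C)) (com_rho_map X).
Qed.

Definition rquot_rho (x : rquot W) : tensor (rquot W) C := rho_pr (repr x).

Lemma rquot_rho_proj x : rquot_rho (pr x) = tmap pr (@id C) (com_rho x).
Proof.
have [rD _] := rho_pr_map; apply/eqP; rewrite -subr_eq0 -(additive_mapN _ rD) -rD.
by apply/eqP/W_sub/rquot_repr.
Qed.

Fact rquot_rho_map : rmod_map rquot_rho.
Proof.
have [rD rR] := rho_pr_map.
split=> [|x a].
  elim/rquot_ind=> u; elim/rquot_ind=> v.
  by rewrite -rquot_classD !rquot_rho_proj; apply: rD.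
elim/rquot_ind: x => u; rewrite -[rquot_class W u *< a](rhomR pr) !rquot_rho_proj.
exact: rR.
Qed.

Fact rquot_coassoc x :
  tassoc (tmap rquot_rho (@id C) (rquot_rho x)) = tmap id cor_delta (rquot_rho x).
Proof.
have dL : lmod_map (@cor_delta _ _ C) by case: (cor_delta_map C) => -[].
elim/rquot_ind: x => u; have prR := rfun_map pr; have rX := com_rho_map X.
have rQ := rquot_rho_map.
rewrite rquot_rho_proj !tmap_comp//.
rewrite (@eq_tmap _ _ _ _ _ _ (fun y => tmap pr (@id C) (com_rho y)) _ id)//;
  last exact: rquot_rho_proj.
rewrite -(@tmap_comp _ _ _ _ _ _ _ com_rho (tmap pr (@id C)) id id)//;
  last exact: (tmap_rmod_map prR (id_bimod_map C)).
rewrite tassoc_natural// com_coassoc tmap_comp//.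
  by apply: eq_tmap => // c; rewrite tmap_id.
exact: (tmap_lmod_map (id_bimod_map C) (lmod_map_id C)).
Qed.

Fact rquot_counit x : tlift (fun v c => v *< (cor_eps c : A)) (rquot_rho x) = x.
Proof.
elim/rquot_ind: x => u; have prR := rfun_map pr.
rewrite rquot_rho_proj tlift_tmap//; last exact: counit_balanced.
rewrite -[in RHS](com_counit u) -[RHS]/(pr _) (tlift_comp _ _ (rhomD pr)).
by apply: eq_tlift => m c; rewrite rhomR.
Qed.

Definition rquot_comod : comodule C :=
  Comodule rquot_rho_map rquot_coassoc rquot_counit.

Definition rquot_comod_proj : comod_hom X rquot_comod :=
  @ComodHom _ _ _ X rquot_comod pr rquot_rho_proj.

End QuotientComodule.

(** * Cokernels and joint images of colinear maps *)

Section Cokernel.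
Variables (Y : comodule C) (L : Type) (X : L -> comodule C).
Variable f : forall l, comod_hom (X l) Y.

(** Taking a family of maps serves both for the cokernel of a single map and for the joint image of
    all maps out of the generators. *)
Inductive comod_span : Y -> Prop :=
| comod_span_im l x : comod_span (f l x)
| comod_span0 : comod_span 0
| comod_spanD u v : comod_span u -> comod_span v -> comod_span (u + v).

Lemma comod_spanR u a : comod_span u -> comod_span (u *< a).
Proof.
elim=> [l x||v w _ IHv _ IHw].
- by rewrite -rhomR; apply: comod_span_im.
- by rewrite (additive_map0 (ractDl a)); apply: comod_span0.
- by rewrite ractDl; apply: comod_spanD.
Qed.

Definition comod_span_sub : rsubmod Y := RSubmod comod_span0 comod_spanD comod_spanR.

(** Let [pr] be the projection. By colinearity [rho (f l x)] projects to the image of [rho x] under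
    [(pr f_l) (x) C], and [pr f_l = 0]. *)
Fact comod_span_rho y :
  comod_span_sub y -> tmap (rquot_proj comod_span_sub) (@id C) (com_rho y) = 0.
Proof.
have prR := rfun_map (rquot_proj comod_span_sub).
have [rD _] := com_rho_map Y.
elim=> [l x||v w _ IHv _ IHw].
- rewrite chom_colinear tmap_comp//; try exact: rfun_map.
  rewrite -[RHS](tmap0l _ (@id C) (com_rho x)); apply: eq_tmap => // m.
  by apply/rquot_proj_eq0; apply: comod_span_im.
- by rewrite (additive_map0 rD) (additive_map0 (tmapD _ _)).
- by rewrite rD tmapD// IHv IHw addr0.
Qed.

Definition comod_coker_proj := rquot_comod_proj comod_span_rho.

Lemma comod_coker_eq0 y : comod_coker_proj y = 0 <-> comod_span y.
Proof. exact: (rquot_proj_eq0 comod_span_sub). Qed.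

Lemma comod_coker_comp l : comod_comp comod_coker_proj (f l) = 0.
Proof. by apply: comod_hom_ext => x; apply/comod_coker_eq0/comod_span_im. Qed.

End Cokernel.

Section Image.
Variables (X Y : comodule C) (f : comod_hom X Y).

Lemma comod_span_imE y : comod_span (fun _ : unit => f) y -> exists x, f x = y.
Proof.
elim=> [_ x||_ _ _ [x <-] _ [y' <-]]; first by exists x.
  by exists 0; apply: (additive_map0 (rhomD f)).
by exists (x + y'); rewrite rhomD.
Qed.

(** The cokernel projection and the zero map agree after [f], so the projection vanishes and the
    image of [f] is everything. *)
Lemma epic_surj : @epic (comod_cat C) X Y f -> forall y, exists x, f x = y.
Proof.
set p := comod_coker_proj (fun _ : unit => f) => f_epi y.
have p0 : p = 0.
  apply: (f_epi _ p 0); rewrite /= (comod_coker_comp (fun _ : unit => f) tt : comod_comp p f = 0).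
  exact: comod_hom_ext.
by apply/comod_span_imE/comod_coker_eq0; rewrite -/p p0.
Qed.

(* Cokernels of comodules are computed in modules. *)
Lemma cokernel_exact (Z : comodule C) (h : comod_hom Y Z) :
  @is_cokernel (comod_cat C) X Y Z f h ->
  forall y, h y = 0 -> exists x, f x = y.
Proof.
move=> [_ /(_ _ _ (comod_coker_comp (fun _ : unit => f) tt)) [m [mh _]]] y hy.
apply/comod_span_imE/comod_coker_eq0.
by rewrite -mh /= hy (additive_map0 (rhomD m)).
Qed.

End Image.

(** The quotient map by this span vanishes after every map out of a [P i]; were it nonzero, the
    generating family would detect it. *)
Lemma generating_span (I : Type) (P : I -> comodule C) (Z : comodule C) :
  @generating (comod_cat C) I P ->
  forall z : Z, comod_span (fun l : {i & comod_hom (P i) Z} => projT2 l) z.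
Proof.
set f := fun l : {i & comod_hom (P i) Z} => projT2 l.
move=> P_gen z; apply/comod_coker_eq0; set p := comod_coker_proj f.
suff -> : p = 0 by [].
apply: contrapT => /P_gen [i [h]]; apply.
rewrite /= (comod_coker_comp f (existT _ i h) : comod_comp p h = 0); exact: comod_hom_ext.
Qed.

(** * The coring as a cofree comodule *)

Section CoringAsComodule.

Definition coring_comod : comodule C :=
  Comodule (proj1 (cor_delta_map C)) (@cor_coassoc _ _ C) (@cor_counitr _ _ C).

Lemma rhom_scale_balanced (M : rmodType A) (N : lmodType A) (phi : rhom M A^o) :
  balanced (fun (v : M) (c : N) => (phi v : A) *: c).
Proof.
split=> [c u v|u c d|u a c].
- by rewrite (rhomD phi) scalerDl.
- by rewrite scalerDr.
- by rewrite (rhomR phi) -scalerA.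
Qed.

Lemma rhom_scale_rmod_map (M : rmodType A) (N : bimodType A A) (phi : rhom M A^o) :
  rmod_map (tlift (fun (v : M) (c : N) => (phi v : A) *: c)).
Proof.
have pD := tliftD (rhom_scale_balanced N phi); split=> // x a.
elim/tensor_ind: x => [v c|x y IHx IHy].
  by rewrite ract_pure !(tlift_pure (rhom_scale_balanced N phi)) ractZ.
by rewrite ractDl !pD ractDl IHx IHy.
Qed.

Variable M : comodule C.

(* The adjunction Hom_A(M, A) = Hom_C(M, C): phi corresponds to
   (phi (x)_A C) rho_M, with inverse f |-> eps f. *)
Section Cofree.
Variable phi : rhom M A^o.

Definition cofree_fun : M -> coring_comod :=
  fun u => tlift (fun (v : M) (c : C) => (phi v : A) *: c) (com_rho u).

Fact cofree_map : rmod_map cofree_fun.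
Proof. exact: rmod_map_comp (rhom_scale_rmod_map C phi) (com_rho_map M). Qed.

Definition cofree_rhom : rhom M coring_comod := RHom cofree_map.

(** Put [F = phi (x) C (x) C]. Left linearity of [cor_delta] makes the left side
    [F (M (x) cor_delta) rho]; coassociativity of [M] turns this into [F (rho (x) C) rho], which is
    the right side. *)
Fact cofree_colinear : @colinear _ _ _ M coring_comod cofree_rhom.
Proof.
move=> u; have [[dD dR] dZ] := cor_delta_map C.
have rM := com_rho_map M; have pR := rhom_scale_rmod_map C phi.
rewrite -[LHS]/(cor_delta (cofree_fun u)).
pose F := tlift (fun (v : M) (t : tensor C C) => (phi v : A) *: t).
have FB := rhom_scale_balanced (tensor C C) phi; have FD : additive_map F := tliftD FB.
transitivity (F (tmap id cor_delta (com_rho u))).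
  rewrite [RHS](tlift_tmap _ FB)// [LHS]tlift_comp//.
  by apply: eq_tlift => v c; rewrite dZ.
rewrite -com_coassoc -[RHS](@tmap_comp _ _ _ _ _ _ _ com_rho _ id id)//.
elim/tensor_ind: (tmap _ _ _) => [y c|x y IHx IHy]; last first.
  by rewrite tassocD FD IHx IHy (tmapD pR).
rewrite (tmap_pure pR)//; elim/tensor_ind: y => [v d|x y IHx IHy].
  by rewrite tassoc_pure [LHS](tlift_pure FB) (tlift_pure (rhom_scale_balanced C phi))
    scale_pure.
by rewrite tpureDl tassocD FD IHx IHy (proj1 pR) tpureDl.
Qed.

Definition cofree_hom : comod_hom M coring_comod := ComodHom cofree_colinear.

Lemma cor_eps_cofree u : cor_eps (cofree_hom u : C) = phi u.
Proof.
have [[eD eR] eZ] := cor_eps_map C.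
rewrite -[in RHS](com_counit u) (tlift_comp _ _ (rhomD phi)) [LHS]tlift_comp//.
by apply: eq_tlift => v c; rewrite eZ rhomR.
Qed.

End Cofree.

Variable f : comod_hom M coring_comod.

Definition cofree_dual : rhom M A^o :=
  RHom (rmod_map_comp (proj1 (cor_eps_map C)) (rfun_map f)).

(** Colinearity of [f] turns the left side into [(eps (x) C) Delta (f u)], to which the left counit
    law of [C] applies. *)
Lemma cofree_dualK u : cofree_hom cofree_dual u = f u.
Proof.
rewrite -[RHS](@cor_counitl _ _ C) -[cor_delta _]/(com_rho (f u : coring_comod)).
rewrite chom_colinear [RHS]tlift_tmap//; last exact: rfun_map.
have [[eD eR] eZ] := cor_eps_map C; split=> [c x y|x c d|x a c].
- by rewrite eD scalerDl.
- by rewrite scalerDr.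
- by rewrite eR -scalerA.
Qed.

End CoringAsComodule.

Lemma cofree_natural (M N : comodule C) (g : comod_hom M N) (phi : rhom N A^o) u :
  cofree_hom phi (g u) = cofree_hom (rhom_comp phi g) u.
Proof.
rewrite -[LHS]/(tlift _ (com_rho (g u))) chom_colinear tlift_tmap//.
  exact: rhom_scale_balanced.
exact: rfun_map.
Qed.

(** * Universal property of the coproduct *)

Section CoproductUniversal.
Variables (I : choiceType) (P : I -> comodule C) (Y : comodule C).
Variable f : forall i, comod_hom (P i) Y.

Definition coprod_desc_fun : coprod_comod P -> Y := dsum_lift (fun i x => f i x).

Lemma coprod_desc_inj i (x : P i) : coprod_desc_fun (coprod_inj P i x) = f i x.
Proof. by apply: dsum_lift_inj => j; apply: rhomD. Qed.

Fact coprod_desc_map : rmod_map coprod_desc_fun.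
Proof.
have fD : additive_map coprod_desc_fun by apply: dsum_liftD => i; apply: rhomD.
split=> // u a; elim/dsum_ind: u => [|i x|u v IHu IHv].
- by rewrite (additive_map0 (ractDl a)) !(additive_map0 fD) (additive_map0 (ractDl a)).
- by rewrite -rhomR !coprod_desc_inj rhomR.
- by rewrite ractDl !fD ractDl IHu IHv.
Qed.

Fact coprod_desc_colinear : colinear (RHom coprod_desc_map).
Proof.
have [fD _] := coprod_desc_map; have [rD _] := com_rho_map Y.
apply: dsum_lift_unique => [u v|u v|i x].
- by rewrite [RHom _ _]fD rD.
- by rewrite [com_rho _]coprod_rhoD (tmapD coprod_desc_map (lmod_map_id C)).
transitivity (com_rho (f i x)); first by congr com_rho; apply: coprod_desc_inj.
transitivity (tmap coprod_desc_fun (@id C) (com_rho (coprod_inj P i x)));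
  last by [].
rewrite (chom_colinear (coprod_inj P i)) tmap_comp//;
  [|exact: rfun_map|exact: coprod_desc_map].
by rewrite chom_colinear; apply: eq_tmap => // y; rewrite coprod_desc_inj.
Qed.

Definition coprod_desc : comod_hom (coprod_comod P) Y := ComodHom coprod_desc_colinear.

End CoproductUniversal.
End Comodules.

(** Take the union of the supports of the images of finitely many generators; by linearity every
    other component of [e] vanishes. *)
Lemma fg_dsum_supp (R : pzRingType) (X : rmodType R) (S : choiceType)
    (Q : S -> rmodType R) (e : rhom X (dsum Q)) : finitely_generated X ->
  exists2 s : seq S, uniq s & forall x i, i \notin s -> e x i = 0.
Proof.
move=> [n [b b_gen]]; pose s := flatten [seq dsum_supp (e (b k)) | k <- enum 'I_n].
exists (undup s) => [|x i]; first exact: undup_uniq.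
rewrite mem_undup => i_s; have [a ->] := b_gen x.
rewrite -[LHS]/(dsum_proj Q i (e _)) (additive_map_sum _ _ (rhomD e)).
rewrite (additive_map_sum _ _ (rhomD _)) big1// => k _.
rewrite !rhomR [dsum_proj _ _ _]dsum_suppP ?(additive_map0 (ractDl _))//.
apply: contra i_s => ik; apply/flattenP; exists (dsum_supp (e (b k))) => //.
by apply: map_f; rewrite mem_enum.
Qed.

(** * The canonical map as a morphism of corings *)

Section CanonicalMap.
Variables (K : comPzRingType) (A : kalgebra K) (C : coring A).
Variables (I : choiceType) (P : I -> comodule C).
Hypothesis Pfgp : forall i, fg_projective (P i).

Local Notation Sigma := (coprod_comod P).
Local Notation T := (comod_end Sigma).
Local Notation SB := (comod_bimod Sigma).
Local Notation Sdual := (rhom SB A^o).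
Local Notation inj i := (coprod_inj P i).
Local Notation proj i := (coprod_proj P i).
Local Notation can := (comatrix_can Pfgp).

Lemma can_pureE (phi : Sdual) (u : SB) :
  can (phi \ox u) = cofree_hom (M := Sigma) phi u.
Proof. exact: comatrix_can_pure. Qed.

Lemma canD : additive_map can.
Proof. exact: tliftD (comatrix_can_balanced P). Qed.

Lemma can_bimod_map : bimod_map can.
Proof.
split; first split=> [|x a]; first exact: canD.
  elim/tensor_ind: x => [phi u|x y IHx IHy]; last by rewrite ractDl !canD ractDl IHx IHy.
  by rewrite [_ *< a]ract_pure !can_pureE; apply: (rhomR (cofree_hom _)).
move=> a x; elim/tensor_ind: x => [phi u|x y IHx IHy].
  rewrite [a *: _]scale_pure !can_pureE [RHS]tlift_comp; last exact: scalerDr.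
  by apply: eq_tlift => v c; rewrite scalerA.
by rewrite scalerDr !canD scalerDr IHx IHy.
Qed.

Lemma can_eps c : cor_eps (can c) = comatrix_eps c.
Proof.
move: c; apply: tensor_eq => [x y|x y|phi u]; last 1 first.
- by rewrite can_pureE cor_eps_cofree comatrix_eps_pure.
- by rewrite canD; case: (cor_eps_map C) => -[-> _] _.
- exact: comatrix_epsD.
Qed.

(** On the summand [P i], [x |-> can (phi (x) iota_i x)] is a colinear map [h], so the left side is
    [(h (x) C) rho(x)]; expanding the [P i] factor in the dual basis gives the comatrix formula. *)
Lemma can_delta c : cor_delta (can c) = tmap can can (comatrix_delta Pfgp c).
Proof.
have [canR canZ] := can_bimod_map; have canL : lmod_map can by split=> //; apply: canD.
have [[dD _] _] := cor_delta_map C; have tD := tmapD canR canL.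
have cD := comatrix_deltaD Pfgp.
elim/comatrix_ind: c => [|phi i x|x y IHx IHy]; last first.
- by rewrite canD cD dD tD IHx IHy.
- rewrite comatrix_delta_pure_inj /comatrix_term (additive_map_sum _ _ tD).
  pose h := comod_comp (cofree_hom (M := Sigma) phi) (inj i).
  have -> : can ((phi : Sdual) \ox (inj i x : SB)) = h x by apply: can_pureE.
  rewrite [LHS](chom_colinear h).
  transitivity (\sum_(p <- dual_basis (Pfgp i)) (h p.2 : C) \ox
      (tlift (fun (v : P i) (c : C) => (p.1 v : A) *: c) (com_rho x) : C)); last first.
    apply: eq_bigr => p _; rewrite (tmap_pure canR canL) idem_inj !can_pureE.
    congr (_ \ox _); rewrite [RHS]cofree_natural; apply: eq_tlift => v c.
    by congr (_ *: _); congr (p.1 _); symmetry; apply: coprod_projK.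
  have pD (p : rhom (P i) A^o * P i) := tliftD (rhom_scale_balanced C p.1).
  (* Both sides are additive in [com_rho x], which may thus be replaced by a pure tensor. *)
  elim/tensor_ind: (com_rho x) => [v c|y z IHy IHz].
    rewrite (tmap_pure (rfun_map h) (lmod_map_id C)).
    rewrite [in LHS](dual_basisP (Pfgp i) v) (additive_map_sum _ _ (rhomD h)) tpure_suml.
    apply: eq_bigr => p _.
    by rewrite (tlift_pure (rhom_scale_balanced C p.1)) rhomR tpureA.
  rewrite (tmapD (rfun_map h) (lmod_map_id C)) IHy IHz -big_split.
  by apply: eq_bigr => p _; rewrite pD tpureDr.
- by rewrite (additive_map0 canD) (additive_map0 dD) (additive_map0 cD) (additive_map0 tD).
Qed.

Lemma can_coring_map : @coring_map K A (comatrix_coring Pfgp) C can.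
Proof. by split; [apply: can_bimod_map|apply: can_delta|apply: can_eps]. Qed.

(** * Covering the comatrix coring by generators *)

Local Notation J := (Sdual * I)%type.
Local Notation PJ := (fun j : J => P j.2).
Local Notation G := (coprod_comod PJ).

(* By the adjunction for cofree comodules, every colinear map P i -> C is
   x |-> can (phi (x) iota_i x) for some phi, so that J (redundantly) indexes all
   of them; can_cover is the induced map, factored as can after comatrix_cover. *)
Definition comatrix_cover : G -> comatrix P :=
  dsum_lift (fun (j : J) (x : P j.2) => (j.1 : Sdual) \ox (inj j.2 x : SB)).

Definition can_cover : comod_hom G (coring_comod C) :=
  coprod_desc (fun j : J => comod_comp (cofree_hom (M := Sigma) j.1) (inj j.2)).

Lemma comatrix_coverDr (j : J) :
  additive_map (fun x : P j.2 => (j.1 : Sdual) \ox (inj j.2 x : SB)).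
Proof. by move=> x y; rewrite (rhomD (inj j.2)) tpureDr. Qed.

Lemma comatrix_coverD : additive_map comatrix_cover.
Proof. exact: dsum_liftD comatrix_coverDr. Qed.

(** This passes questions about [can] to the colinear map [can_cover], to which the categorical
    hypotheses apply. *)
Lemma can_coverE g : can_cover g = can (comatrix_cover g).
Proof.
move: g; apply: dsum_lift_unique => [||j x]; first exact: (rhomD can_cover).
  exact: additive_map_comp canD comatrix_coverD.
rewrite [RHS](congr1 can (dsum_lift_inj comatrix_coverDr x)) can_pureE.
exact: coprod_desc_inj.
Qed.

Lemma comatrix_cover_surj c : exists g, comatrix_cover g = c.
Proof.
elim/comatrix_ind: c => [|phi i x|_ _ [g <-] [g' <-]].
- by exists 0; apply: additive_map0 comatrix_coverD.
- exists (coprod_inj PJ (phi, i) x); exact: (dsum_lift_inj comatrix_coverDr).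
- by exists (g + g'); rewrite comatrix_coverD.
Qed.

(* As P i is finitely generated, e only meets finitely many summands, and the
   middle T-linearity collects comatrix_cover (e y) into one pure tensor whose
   first factor is eps (can_cover e pi_i). *)
Lemma comatrix_cover_eq0 i (e : comod_hom (P i) G) :
  (forall y, can_cover (e y) = 0) -> forall y, comatrix_cover (e y) = 0.
Proof.
move=> e0 y; have [s s_uniq es] := fg_dsum_supp e (proj1 (Pfgp i)).
have coverE x : comatrix_cover (e x) =
    \sum_(j <- s) (j.1 : Sdual) \ox (inj j.2 (coprod_proj PJ j (e x)) : SB).
  by apply: (dsum_liftE comatrix_coverDr) => // j; apply: es.
pose t j : T :=
  comod_comp (inj j.2) (comod_comp (coprod_proj PJ j) (comod_comp e (proj i))).
have tE j x : inj j.2 (coprod_proj PJ j (e x)) = t j *: (inj i x : SB).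
  by rewrite -{1}(coprod_projK x).
rewrite coverE; under eq_bigr do rewrite tE -tpureA.
rewrite -tpure_suml (_ : \sum_(j <- s) _ = 0) ?tpure0l//.
apply: rhom_ext => v; rewrite rhom_sumE.
transitivity (comatrix_eps (comatrix_cover (e (proj i v)))).
  rewrite coverE (additive_map_sum _ _ (@comatrix_epsD _ _ _ _ _)).
  by apply: eq_bigr => j _; rewrite comatrix_eps_pure.
rewrite -can_eps -can_coverE e0.
by case: (cor_eps_map C) => -[eD _] _; apply: additive_map0 eD.
Qed.

(** * Bijectivity of the canonical map *)

Section Generating.
Hypothesis P_generating : @generating (comod_cat C) I P.

(** Distinct maps out of [C] are separated by some [h : P i -> C]; by the adjunction such an [h] is
    a component of [can_cover], after which they agree. *)
Lemma can_cover_epic : @epic (comod_cat C) G (coring_comod C) can_cover.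
Proof.
move=> W f g fg; apply: contrapT => /P_generating [i [h]]; apply.
apply: comod_hom_ext => x /=.
(* The form [eps h] on [P i], extended by zero to the other summands of [Sigma]. *)
pose phi : Sdual := rhom_comp (cofree_dual h) (proj i).
have -> : h x = can_cover (coprod_inj PJ (phi, i) x).
  transitivity (cofree_hom (M := Sigma) phi (inj i x)); last exact/esym/coprod_desc_inj.
  rewrite -[LHS]cofree_dualK [RHS]cofree_natural.
  congr (cofree_hom _ x); apply: rhom_ext => y /=.
  by congr (cor_eps (h _)); symmetry; apply: coprod_projK.
exact: (congr1 (fun k : comod_hom G W => k (coprod_inj PJ (phi, i) x)) fg).
Qed.

Lemma can_surj c : exists x, can x = c.
Proof.
have [g gc] := epic_surj can_cover_epic c.
by exists (comatrix_cover g); rewrite -can_coverE.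
Qed.

Lemma can_inj : abelian (comod_cat C) -> injective can.
Proof.
move=> C_abelian; suff can0 c : can c = 0 -> c = 0.
  move=> c d cd; apply/eqP; rewrite -subr_eq0; apply/eqP/can0.
  by rewrite canD (additive_mapN _ canD) cd subrr.
have [g <-] := comatrix_cover_surj c; rewrite -can_coverE => g0.
(* In an abelian category the epimorphism [can_cover] is a cokernel; exactness then lifts [g] to
   [Z]. *)
have [Z [k k_coker]] := ab_epi C_abelian can_cover_epic.
have [z <-] := cokernel_exact k_coker g0.
(* Additivity of [comatrix_cover] leaves only the images of maps [f : P i -> Z], and there
   [can_cover k f = 0]. *)
elim: (generating_span P_generating z) => [[i f] x||u v _ IHu _ IHv] /=.
- apply: (@comatrix_cover_eq0 i (comod_comp k f)) => y /=.
  exact: (congr1 (fun e : comod_hom Z (coring_comod C) => e (f y)) (proj1 k_coker)).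
- by rewrite (additive_map0 (rhomD k)) (additive_map0 comatrix_coverD).
- by rewrite (rhomD k) comatrix_coverD IHu IHv addr0.
Qed.

End Generating.
End CanonicalMap.

(** The identities for the inverse [g] follow from those for [f]: linearity by applying the
    injective [f], comultiplication and counit by writing [d = f (g d)]. *)
Lemma coring_iso_bij (K : comPzRingType) (A : kalgebra K) (C D : coring A)
    (f : C -> D) : coring_map f -> injective f -> (forall d, exists c, f c = d) ->
  coring_iso f.
Proof.
move=> fM f_inj f_surj; split=> //; have [[[fD fR] fZ] fdelta feps] := fM.
have [g fg] := choice f_surj; have gf : cancel f g by move=> c; apply: f_inj.
have gL : lmod_map g.
  by split=> [x y|a x]; apply: f_inj; rewrite ?fD ?fZ !fg.
have gR : rmod_map g by split=> [|x a]; [case: gL | apply: f_inj; rewrite fR !fg].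
exists g; split=> //; split=> [|d|d]; first by split=> //; case: gL.
- rewrite -[in RHS](fg d) fdelta tmap_comp// -[LHS]tmap_id.
  by apply: eq_tmap.
- by rewrite -[in RHS](fg d) feps.
Qed.

Theorem theorem3p8 (K : comPzRingType) (A : kalgebra K) (C : coring A)
    (C_abelian : abelian (comod_cat C))
    (I : choiceType) (P : I -> comodule C)
    (P_generating : @generating (comod_cat C) I P)
    (P_fgp : forall i : I, fg_projective (P i)) :
  @coring_iso K A (comatrix_coring P_fgp) C (comatrix_can P_fgp).
Proof.
apply: coring_iso_bij; first exact: can_coring_map.
  exact: can_inj P_generating C_abelian.
exact: can_surj P_generating.
Qed.
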